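(* Let $\nu>0$, $\lambda>0$, $\mu>0$, $\eta\in\mathbb{R}\setminus\{0\}$, $m\ge 1$, and let $F(V,t)=\nu V$ ($V\in\mathbb{R}$, $t>0$), $h(x)=\eta x^m$ and $\Phi(x)=-\mu\sin(\lambda x)$ ($x>0$). Put $\delta=\lambda-\nu\mu$ and $c=\frac{2^{m-1}m\eta}{\sqrt{\pi}}\Gamma\left(\frac m2\right)$. Then the heat flux at the boundary $x=0$ corresponding to the solution $u$ to Problem P given by the integral representation described in the context is as follows. 1. If $\delta\ne 0$, then for $t>0$ $$u_x(0,t)=\begin{cases}\dfrac{\eta}{\delta}\big(\lambda-\nu\mu\exp(-\lambda\delta t)\big) & \text{if }m=1,\\[4pt] \dfrac{c\lambda}{\delta}t^{(m-1)/2}-\dfrac{c(m-1)\nu\mu}{2\delta}\exp(-\lambda\delta t)\displaystyle\int_0^t\tau^{(m-3)/2}\exp(\lambda\delta\tau)\,d\tau & \text{if }m>1.\end{cases}$$ 2. If $\delta=0$, then for $t>0$ $$u_x(0,t)=\begin{cases}\eta(1+\lambda^2t) & \text{if }m=1,\\[2pt] c\,t^{(m-1)/2}+\dfrac{2c\lambda^2}{m+1}t^{(m+1)/2} & \text{if }m>1.\end{cases}$$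
   Context: Problem P: $u_t(x,t)-u_{xx}(x,t)=-\Phi(x)F(u_x(0,t),t)$ for $x>0,t>0$; $u(x,0)=h(x)$ for $x>0$; $u(0,t)=0$ for $t>0$. For $F(V,t)=\nu V$, the solution $u$ considered is $$u(x,t)=\int_0^{+\infty}G(x,t,\xi,0)h(\xi)\,d\xi-\nu\int_0^t\Big(\int_0^{+\infty}G(x,t,\xi,\tau)\Phi(\xi)\,d\xi\Big)V(\tau)\,d\tau,\quad x\ge0,\ t\ge 0,$$ where $G(x,t,\xi,\tau)=K(x,t,\xi,\tau)-K(-x,t,\xi,\tau)$, $K(x,t,\xi,\tau)=\frac{1}{2\sqrt{\pi(t-\tau)}}\exp\big(-(x-\xi)^2/(4(t-\tau))\big)$, and $V(t)=u_x(0,t)$ satisfies the Volterra integral equation $$V(t)=V_0(t)-\nu\int_0^tR(t-\tau)V(\tau)\,d\tau,\quad t>0,$$ with $V_0(t)=\frac{1}{\sqrt{\pi t}}\int_0^{+\infty}\exp(-\xi^2/4t)h'(\xi)\,d\xi$ and $R(t)=\frac{1}{2\sqrt{\pi}\,t^{3/2}}\int_0^{+\infty}\xi\exp(-\xi^2/4t)\Phi(\xi)\,d\xi$. $\Gamma$ is the Gamma function. *)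

(* Defs.v *)
From HB Require Import structures.
From mathcomp Require Export all_boot all_order all_algebra.
From mathcomp Require Export all_classical all_reals all_analysis.
Export Order.TTheory GRing.Theory Num.Theory.
Export numFieldNormedType.Exports.

Set Implicit Arguments.
Unset Strict Implicit.
Unset Printing Implicit Defensive.

Local Open Scope ring_scope.
Local Open Scope classical_set_scope.

Section HeatProblem.
Context {R : realType}.
Implicit Types (h Phi V : R -> R) (F u : R -> R -> R) (x t xi tau nu : R).

Local Notation mu := (@lebesgue_measure R).

Definition Gamma (s : R) : R :=
  \int[mu]_(y in `]0, +oo[) (y `^ (s - 1) * expR (- y)).

Definition heat_kernel x t xi tau : R :=
  (2 * Num.sqrt (pi * (t - tau)))^-1
  * expR (- ((x - xi) ^+ 2 / (4 * (t - tau)))).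

Definition green x t xi tau : R :=
  heat_kernel x t xi tau - heat_kernel (- x) t xi tau.

(* The functions u are only meaningful on x >= 0, so u_x(0,t) is the right
   derivative at x = 0. *)
Definition boundary_quotient u t : R -> R := fun x => (u x t - u 0 t) / x.

Definition has_boundary_flux u t (l : R) : Prop :=
  boundary_quotient u t x @[x --> 0^'+] --> l.

Definition boundary_flux u t : R :=
  lim (boundary_quotient u t x @[x --> 0^'+]).

(* Convergence of the quotient defining boundary_flux is deliberately not
   among the conditions: statements assuming this predicate are then stronger,
   and convergence has to be proved together with the value of the flux. *)
Record solves_heat_problem h Phi F u : Prop := SolvesHeatProblem {
  heat_derivable_t : forall x t, 0 < x -> 0 < t -> derivable (u x) t 1;
  heat_derivable_x : forall x t, 0 < x -> 0 < t -> derivable (u^~ t) x 1;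
  heat_derivable_xx :
    forall x t, 0 < x -> 0 < t -> derivable (derive1 (u^~ t)) x 1;
  heat_equation : forall x t, 0 < x -> 0 < t ->
    derive1 (u x) t - derive1n 2 (u^~ t) x = - Phi x * F (boundary_flux u t) t;
  heat_initial : forall x, 0 < x -> u x 0 = h x;
  heat_boundary : forall t, 0 < t -> u 0 t = 0
}.

Definition volterra_source h t : R :=
  (Num.sqrt (pi * t))^-1
  * \int[mu]_(xi in `]0, +oo[) (expR (- (xi ^+ 2 / (4 * t))) * derive1 h xi).

Definition volterra_kernel Phi t : R :=
  (2 * Num.sqrt pi * t `^ (3 / 2))^-1
  * \int[mu]_(xi in `]0, +oo[) (xi * expR (- (xi ^+ 2 / (4 * t))) * Phi xi).

(* Local integrability on [0, +oo[ is what makes the Lebesgue integrals of V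
   meaningful (the library integral is total). *)
Definition volterra_solution nu h Phi V : Prop :=
  (forall t, 0 < t -> mu.-integrable `]0, t[ (EFin \o V)) /\
  (forall t, 0 < t ->
    V t = volterra_source h t
          - nu * \int[mu]_(tau in `]0, t[) (volterra_kernel Phi (t - tau) * V tau)).

Definition integral_representation nu h Phi V x t : R :=
  \int[mu]_(xi in `]0, +oo[) (green x t xi 0 * h xi)
  - nu * \int[mu]_(tau in `]0, t[)
      ((\int[mu]_(xi in `]0, +oo[) (green x t xi tau * Phi xi)) * V tau).

End HeatProblem.

(* Main.v *)
Require Import Defs.
From mathcomp Require Import measurable_realfun normal_distribution.
From mathcomp Require Import ring lra.

(** The Green function vanishes at [x = 0], so differentiating the integral
    representation there turns the initial datum [h] into [volterra_kernel h],
    which one integration by parts identifies with the Volterra source [V0], and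
    turns the forcing term into the convolution of the Volterra equation. Hence
    [u_x(0,t) = V(t)], and only [V] is to be computed. By the Fourier transform
    of the Gaussian, a sine datum keeps its shape under the Dirichlet heat flow,
    which makes the kernel [R] a pure exponential; the Volterra equation is then
    a linear first-order ODE for the primitive of [exp(lambda^2 t) V(t)]. Since
    [V0(t) = c t^((m-1)/2)], its solution is an explicit integral. *)

(** Taking the limit in [x] under the time integral would require control of the forcing near
    [tau = t], where the Green function is singular. A sine source avoids this: its inner integral
    is exactly a multiple of sin (lambda x) exp (- lambda^2 (t - tau)), so the forcing term is sin
    (lambda x) times a number depending on [t] alone, and only the limit of sin (lambda x) / x is
    left. The kernel R is not integrated directly either: it is the limit of the same boundary
    quotient for sine data, hence read off from the explicit heat flow. The function V is only known
    to be locally integrable, so its continuity must be recovered from the Volterra equation before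
    any ODE makes sense. All dominations reduce to one estimate: powers are bounded by exponentials,
    and a Gaussian times an exponential is bounded by a multiple of exp (-x) after completing the
    square. For 1 < m < 3 the final formula contains tau^((m-3)/2), singular at 0; integrals over
    []0, t[] are therefore evaluated through limits of primitives at the open end. *)

Local Open Scope ring_scope.
Local Open Scope classical_set_scope.

(** * Improper integrals of derivatives *)

Section Integration.
Context {R : realType}.
Local Notation leb := (@lebesgue_measure R).
Implicit Types (f g F : R -> R) (D : set R).

Lemma cvg_Rintegral_exhaustion D (J : nat -> set R) f :
  measurable (D : set (measurableTypeR R)) ->
  (forall n, measurable (J n : set (measurableTypeR R))) ->
  (forall n, J n `<=` D) ->
  (forall x, D x -> \forall n \near \oo, J n x) ->
  leb.-integrable D (EFin \o f) ->
  \int[leb]_(x in J n) f x @[n --> \oo] --> \int[leb]_(x in D) f x.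
Proof.
move=> mD mJ JD exJ intf.
have DJ n : D `&` J n = J n by exact/setIidPr.
have intfJ n : leb.-integrable D (EFin \o (f \_ (J n))).
  rewrite -restrict_EFin; apply/integrable_restrict => //.
  by rewrite DJ; apply: integrableS intf => //; exact: mJ.
rewrite [X in X @ _ --> _](_ : _ =
    fun n => fine (\int[leb]_(x in D) (EFin \o (f \_ (J n))) x)); last first.
  by apply/funext => n; rewrite -[in LHS]DJ Rintegral_mkcondr.
apply: fine_cvg; rewrite /Rintegral fineK; last exact: integrable_fin_num.
(* Truncations of [f] to [J n] are dominated by |f|, and at each point of [D] they are eventually
   equal to [f]. *)
have [|||||//] := @dominated_convergence _ _ _ leb D mD
    (fun n => EFin \o (f \_ (J n))) (EFin \o f) (EFin \o (fun x => `|f x|)).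
- by move=> n; exact: measurable_int (intfJ n).
- exact: measurable_int intf.
- apply: aeW => x Dx; apply: cvg_near_cst; near=> n.
  by rewrite /= patchE mem_set//; near: n; exact: exJ.
- exact: integrable_norm.
- apply: aeW => x n Dx; rewrite /= lee_fin patchE; case: ifP => _ //.
  by rewrite normr0.
Unshelve. all: by end_near. Qed.

Lemma Rintegral_segment_FTC f F a b : a < b ->
  (forall x, a <= x <= b -> {for x, continuous f}) ->
  (forall x, a <= x <= b -> is_derive x 1 F (f x)) ->
  \int[leb]_(x in `[a, b]) f x = F b - F a.
Proof.
move=> ab cf dF; rewrite /Rintegral (@continuous_FTC2 _ f F)//.
- apply: continuous_in_subspaceT => x; rewrite inE/= in_itv/= => xab.
  exact: cf.
- have cF x : a <= x <= b -> {for x, continuous F}.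
    move=> /dF dFx.
    by apply/differentiable_continuous/derivable1_diffP; exact: ex_derive.
  split.
  + move=> x; rewrite in_itv/= => /andP[ax xb].
    have := dF x; rewrite !ltW// => /(_ isT) ?; exact: ex_derive.
  + by apply: cvg_at_right_filter; apply: cF; rewrite lexx ltW.
  + by apply: cvg_at_left_filter; apply: cF; rewrite lexx ltW.
- move=> x; rewrite in_itv/= => /andP[ax xb].
  by rewrite derive1E; have := dF x; rewrite !ltW// => /(_ isT) ?; rewrite derive_val.
Qed.

Lemma Rintegral_exhaustion_FTC D f F (a b : nat -> R) (la lb : R) :
  measurable (D : set (measurableTypeR R)) ->
  (forall n, a n < b n) -> (forall n, `[a n, b n] `<=` D) ->
  (forall x, D x -> \forall n \near \oo, a n <= x <= b n) ->
  leb.-integrable D (EFin \o f) ->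
  (forall x, D x -> {for x, continuous f}) ->
  (forall x, D x -> is_derive x 1 F (f x)) ->
  F (a n) @[n --> \oo] --> la -> F (b n) @[n --> \oo] --> lb ->
  \int[leb]_(x in D) f x = lb - la.
Proof.
move=> mD ab abD exD intf cf dF Fa Fb.
have h : \int[leb]_(x in `[a n, b n]) f x @[n --> \oo] --> \int[leb]_(x in D) f x.
  apply: (@cvg_Rintegral_exhaustion D (fun n => `[a n, b n]%classic)) => //.
have h2 : \int[leb]_(x in `[a n, b n]) f x @[n --> \oo] --> lb - la.
  rewrite (_ : (fun _ => _) = fun n => F (b n) - F (a n)); first exact: cvgB.
  apply/funext => n; apply: Rintegral_segment_FTC => // x xab.
    by apply: cf; apply: (abD n); rewrite /= in_itv.
  by apply: dF; apply: (abD n); rewrite /= in_itv.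
exact: (cvg_unique _ h h2).
Unshelve. all: by end_near. Qed.

(** For [f] nonnegative, integrability is a conclusion: monotone convergence over the growing
    segments gives the integral of |f| the finite value [lb - la]. *)
Lemma ge0_integrable_exhaustion_FTC D f F (a b : nat -> R) (la lb : R) :
  measurable (D : set (measurableTypeR R)) ->
  (forall n, a n < b n) -> (forall n, `[a n, b n] `<=` D) ->
  nonincreasing_seq a -> nondecreasing_seq b ->
  (forall x, D x -> \forall n \near \oo, a n <= x <= b n) ->
  (forall x, D x -> 0 <= f x) -> measurable_fun (D : set (measurableTypeR R)) f ->
  (forall x, D x -> {for x, continuous f}) ->
  (forall x, D x -> is_derive x 1 F (f x)) ->
  F (a n) @[n --> \oo] --> la -> F (b n) @[n --> \oo] --> lb ->
  leb.-integrable D (EFin \o f).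
Proof.
move=> mD ab abD na nb exD f0 mf cf dF Fa Fb.
have DE : D = \bigcup_n `[a n, b n].
  apply/seteqP; split => [x /exD [N _ /(_ N (leqnn _)) aNb]|x [n _ /abD//]].
  by exists N => //=; rewrite in_itv.
apply/integrableP; split; first exact/measurable_EFinP.
rewrite (_ : integral _ _ _ = (lb - la)%:E); first exact: ltry.
transitivity (\int[leb]_(x in \bigcup_n `[a n, b n]) (f x)%:E)%E.
  rewrite -DE; apply: eq_integral => x; rewrite inE => Dx /=.
  by rewrite ger0_norm// f0.
have h : (\int[leb]_(x in `[a n, b n]) (f x)%:E @[n --> \oo] -->
    \int[leb]_(x in \bigcup_n `[a n, b n]) (f x)%:E)%E.
  apply: ge0_nondecreasing_set_cvg_integral => //.
  - move=> n m nm; apply/subsetPset; apply: subset_itv; rewrite bnd_simp.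
      exact: na.
    exact: nb.
  - by move=> n; apply/measurable_EFinP; exact: measurable_funS mf.
  - by move=> n x /abD Dx; rewrite lee_fin f0.
apply: (cvg_unique _ h) => //.
rewrite (_ : (fun _ => _) = EFin \o (fun n => F (b n) - F (a n))).
  by apply: cvg_EFin; [exact: nearW|exact: cvgB].
apply/funext => n /=.
have <- : \int[leb]_(x in `[a n, b n]) f x = F (b n) - F (a n).
  by apply: Rintegral_segment_FTC => // x xab; [apply: cf|apply: dF];
    apply: (abD n); rewrite /= in_itv.
rewrite /Rintegral fineK//; apply: integrable_fin_num => //.
apply: continuous_compact_integrable; first exact: segment_compact.
by apply: continuous_in_subspaceT => x; rewrite inE/= => /abD; exact: cf.
Qed.

End Integration.

Section ImproperFTC.
Context {R : realType}.
Local Notation leb := (@lebesgue_measure R).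
Implicit Types (f g F : R -> R) (t x la lb : R).

Let shrink n : R := n.+1%:R^-1.

Let shrink_gt0 n : 0 < shrink n. Proof. by rewrite invr_gt0. Qed.

Let shrink_le1 n : shrink n <= 1.
Proof. by rewrite invf_le1// ler1n. Qed.

Let shrink_nincr : nonincreasing_seq shrink.
Proof. by move=> n m nm; rewrite lef_pV2 ?posrE// ler_nat ltnS. Qed.

Let cvg_shrink t F la : 0 < t -> F x @[x --> 0^'+] --> la ->
  F (t * shrink n) @[n --> \oo] --> la.
Proof.
move=> t0 /cvg_at_rightP; apply; split; first by move=> n; rewrite mulr_gt0.
rewrite -(mulr0 t); apply: cvgMr; exact: cvg_harmonic.
Qed.

Let near_shrink t x : 0 < t -> 0 < x -> \forall n \near \oo, t * shrink n <= x.
Proof.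
move=> t0 x0.
have /(cvgr_le 0) : t * shrink n @[n --> \oo] --> (0 : R).
  rewrite -[X in _ --> X](mulr0 t); apply: cvgMr; exact: cvg_harmonic.
exact.
Qed.

Let near_nat x : \forall n \near \oo, x <= n.+2%:R :> R.
Proof.
near=> n; rewrite (@le_trans _ _ n%:R) ?ler_nat//; last by rewrite -addn2 leq_addr.
by near: n; exact: nbhs_infty_ger.
Unshelve. all: by end_near. Qed.

Let cvg_nat F lb : F x @[x --> +oo] --> lb -> F n.+2%:R @[n --> \oo] --> lb.
Proof.
by move=> /cvg_pinftyP; apply; apply/cvgryPge => A; exact: near_nat.
Qed.

Lemma Rintegral_0y_FTC f F la lb :
  leb.-integrable `]0, +oo[ (EFin \o f) ->
  (forall x, 0 < x -> {for x, continuous f}) ->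
  (forall x, 0 < x -> is_derive x 1 F (f x)) ->
  F x @[x --> 0^'+] --> la -> F x @[x --> +oo] --> lb ->
  \int[leb]_(x in `]0, +oo[) f x = lb - la.
Proof.
move=> intf cf dF Fla Flb.
(* The segments run from 1/(n+1), at most 1, to n+2, so they are nondegenerate already at n = 0. *)
apply: (@Rintegral_exhaustion_FTC _ `]0, +oo[ f F
   (fun n => 1 * shrink n) (fun n => n.+2%:R)) => //.
- by move=> n; rewrite mul1r (le_lt_trans (shrink_le1 n))// ltr1n.
- move=> n x; rewrite /= !in_itv/= andbT => /andP[+ _]; apply: lt_le_trans.
  by rewrite mulr_gt0.
- move=> x; rewrite /= in_itv/= andbT => x0; near=> n; apply/andP; split.
    by near: n; exact: near_shrink.
  by near: n; exact: near_nat.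
- by move=> x; rewrite /= in_itv/= andbT => x0; exact: cf.
- by move=> x; rewrite /= in_itv/= andbT => x0; exact: dF.
- exact: cvg_shrink.
- exact: cvg_nat.
Unshelve. all: by end_near. Qed.

Lemma ge0_integrable_0y_FTC f F la lb :
  (forall x, 0 < x -> 0 <= f x) ->
  (forall x, 0 < x -> {for x, continuous f}) ->
  (forall x, 0 < x -> is_derive x 1 F (f x)) ->
  F x @[x --> 0^'+] --> la -> F x @[x --> +oo] --> lb ->
  leb.-integrable `]0, +oo[ (EFin \o f).
Proof.
move=> f0 cf dF Fla Flb.
apply: (@ge0_integrable_exhaustion_FTC _ `]0, +oo[ f F
   (fun n => 1 * shrink n) (fun n => n.+2%:R) la lb) => //.
- by move=> n; rewrite mul1r (le_lt_trans (shrink_le1 n))// ltr1n.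
- move=> n x; rewrite /= !in_itv/= andbT => /andP[+ _]; apply: lt_le_trans.
  by rewrite mulr_gt0.
- by move=> n m nm; rewrite !mul1r; exact: shrink_nincr.
- by move=> n m nm; rewrite ler_nat.
- move=> x; rewrite /= in_itv/= andbT => x0; near=> n; apply/andP; split.
    by near: n; exact: near_shrink.
  by near: n; exact: near_nat.
- by move=> x; rewrite /= in_itv/= andbT => x0; exact: f0.
- apply: open_continuous_measurable_fun => // x.
  by rewrite inE/= in_itv/= andbT => x0; exact: cf.
- by move=> x; rewrite /= in_itv/= andbT => x0; exact: cf.
- by move=> x; rewrite /= in_itv/= andbT => x0; exact: dF.
- exact: cvg_shrink.
- exact: cvg_nat.
Unshelve. all: by end_near. Qed.

Lemma Rintegral_0t_FTC f F la t : 0 < t ->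
  leb.-integrable `]0, t[ (EFin \o f) ->
  (forall x, 0 < x -> {for x, continuous f}) ->
  (forall x, 0 < x -> is_derive x 1 F (f x)) ->
  F x @[x --> 0^'+] --> la ->
  \int[leb]_(x in `]0, t[) f x = F t - la.
Proof.
move=> t0 intf cf dF Fla; rewrite Rintegral_itv_bndo_bndc//.
(* The segments all end at [t], hence the domain closed on the right; the factor 1/2 keeps their
   left end strictly below [t] when n = 0. *)
apply: (@Rintegral_exhaustion_FTC _ `]0, t] f F
   (fun n => t * (2^-1 * shrink n)) (fun=> t)) => //.
- move=> n; rewrite gtr_pMr// (@le_lt_trans _ _ 2^-1) ?ler_piMr//.
  by rewrite invf_lt1// ltr1n.
- move=> n x; rewrite /= !in_itv/= => /andP[+ ->]; rewrite andbT.
  by apply: lt_le_trans; rewrite !mulr_gt0.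
- move=> x; rewrite /= in_itv/= => /andP[x0 xt]; near=> n; rewrite xt andbT.
  by rewrite mulrA; near: n; apply: near_shrink => //; rewrite mulr_gt0.
- move/integrableP : intf => [mf foo]; apply/integrableP; split.
    exact/emeasurable_fun_itv_bndo_bndcP.
  rewrite -integral_itv_bndo_bndc//; exact: measurableT_comp.
- by move=> x; rewrite /= in_itv/= => /andP[x0 _]; exact: cf.
- by move=> x; rewrite /= in_itv/= => /andP[x0 _]; exact: dF.
- under eq_cvg do rewrite mulrA.
  by apply: cvg_shrink => //; rewrite mulr_gt0.
- exact: cvg_cst.
Unshelve. all: by end_near. Qed.

Lemma ge0_integrable_0t_FTC f F la t : 0 < t ->
  (forall x, 0 < x -> 0 <= f x) ->
  (forall x, 0 < x -> {for x, continuous f}) ->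
  (forall x, 0 < x -> is_derive x 1 F (f x)) ->
  F x @[x --> 0^'+] --> la ->
  leb.-integrable `]0, t[ (EFin \o f).
Proof.
move=> t0 f0 cf dF Fla.
suff : leb.-integrable `]0, t] (EFin \o f).
  by apply: integrableS => //; apply: subset_itvl; rewrite bnd_simp.
have mf : measurable_fun (`]0, t] : set R) f.
  suff : measurable_fun (`]0, +oo[ : set R) f.
    by apply: measurable_funS => //; exact: subset_itvl.
  apply: open_continuous_measurable_fun => // x.
  by rewrite inE/= in_itv/= andbT => x0; exact: cf.
apply: (@ge0_integrable_exhaustion_FTC _ `]0, t] f F
   (fun n => t * (2^-1 * shrink n)) (fun=> t) la (F t)) => //.
- move=> n; rewrite gtr_pMr// (@le_lt_trans _ _ 2^-1) ?ler_piMr//.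
  by rewrite invf_lt1// ltr1n.
- move=> n x; rewrite /= !in_itv/= => /andP[+ ->]; rewrite andbT.
  by apply: lt_le_trans; rewrite !mulr_gt0.
- by move=> n m nm; rewrite ler_pM2l// ler_pM2l//; exact: shrink_nincr.
- move=> x; rewrite /= in_itv/= => /andP[x0 xt]; near=> n; rewrite xt andbT.
  by rewrite mulrA; near: n; apply: near_shrink => //; rewrite mulr_gt0.
- by move=> x; rewrite /= in_itv/= => /andP[x0 _]; exact: f0.
- by move=> x; rewrite /= in_itv/= => /andP[x0 _]; exact: cf.
- by move=> x; rewrite /= in_itv/= => /andP[x0 _]; exact: dF.
- under eq_cvg do rewrite mulrA.
  by apply: cvg_shrink => //; rewrite mulr_gt0.
- exact: cvg_cst.
Unshelve. all: by end_near. Qed.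

Lemma Rintegral_T_FTC f F la lb :
  leb.-integrable setT (EFin \o f) -> continuous f ->
  (forall x, is_derive x 1 F (f x)) ->
  F x @[x --> -oo] --> la -> F x @[x --> +oo] --> lb ->
  \int[leb]_x f x = lb - la.
Proof.
move=> intf cf dF Fla Flb.
apply: (@Rintegral_exhaustion_FTC _ setT f F
   (fun n => - n.+2%:R) (fun n => n.+2%:R)) => //.
- by move=> n; rewrite (@lt_trans _ _ 0)// oppr_lt0.
- move=> x _; near=> n; apply/andP; split.
    by rewrite lerNl; near: n; exact: near_nat.
  by near: n; exact: near_nat.
- by move=> x _; exact: cf.
- apply: (@cvg_nat (fun x => F (- x))).
  by apply: cvg_comp Fla; exact/cvgNrNy.
- exact: cvg_nat.
Unshelve. all: by end_near. Qed.

End ImproperFTC.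

(** * Gaussian bounds *)

Section Gaussian.
Context {R : realType}.
Local Notation leb := (@lebesgue_measure R).
Implicit Types (f g F phi : R -> R) (s t x y a b C B : R).

Lemma is_derive_expR_comp g x dg :
  is_derive x 1 g dg -> is_derive x 1 (fun y => expR (g y)) (expR (g x) * dg).
Proof. by move=> dgx; apply: is_derive1_comp. Qed.

Lemma is_derive_gauss s xi x : s != 0 ->
  is_derive x 1 (fun y => expR (- ((y - xi) ^+ 2 / (4 * s))))
    (- ((x - xi) / (2 * s)) * expR (- ((x - xi) ^+ 2 / (4 * s)))).
Proof.
move=> s0; have H : is_derive x 1 (fun y => y - xi) 1.
  exact: is_derive_shift.
have := is_deriveN (is_deriveZ (4 * s)^-1 (is_deriveM H H)).
rewrite (_ : - _ = fun y => - ((y - xi) ^+ 2 / (4 * s))); last first.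
  by apply/funext => y; rewrite !fctE expr2; congr (- _); exact: mulrC.
move=> /is_derive_expR_comp/is_derive_eq; apply.
by rewrite [LHS]mulrC /GRing.scale/=; congr (_ * _); field.
Qed.

Lemma continuous_gauss s xi : continuous (fun y => expR (- ((y - xi) ^+ 2 / (4 * s)))).
Proof.
have [->|s0] := eqVneq s 0.
  under eq_fun do rewrite mulr0 invr0 mulr0 oppr0; exact: cst_continuous.
move=> y; apply/differentiable_continuous/derivable1_diffP.
have := is_derive_gauss s xi y s0 => ?; exact: ex_derive.
Qed.

Lemma measurable_continuous D f : continuous f ->
  measurable_fun (D : set (measurableTypeR R)) f.
Proof.
by move=> cf; apply: measurable_funTS; exact: continuous_measurable_fun.
Qed.

Lemma integrable_expRN : leb.-integrable `]0, +oo[ (fun x => (expR (- x))%:E).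
Proof.
have dE x : is_derive x 1 (fun x => - expR (- x)) (expR (- x)).
  have := is_deriveN (is_derive_expR_comp _ _ _ (is_deriveNid x 1)).
  by move=> /is_derive_eq; apply; rewrite mulrN1 opprK.
have cE : continuous (fun x => expR (- x)).
  move=> x; apply: continuous_comp; first exact: opp_continuous.
  exact: continuous_expR.
apply: (@ge0_integrable_0y_FTC R (fun x => expR (- x)) (fun x => - expR (- x))
  (- expR (- 0)) (- 0)).
- by move=> x _; exact: expR_ge0.
- by move=> x _; exact: cE.
- apply: cvg_at_right_filter; apply: cvgN; exact: cE.
- apply: cvgN; exact: cvgr_expR.
Qed.

(** Completing the square: the two exponents differ by a (x - (b + 1) / (2 a))^2. *)
Lemma gauss_le_expRN a b x : 0 < a ->
  expR (- (a * x ^+ 2) + b * x) <= expR ((b + 1) ^+ 2 / (4 * a)) * expR (- x).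
Proof.
move=> a0; rewrite -expRD ler_expR -subr_ge0.
rewrite (_ : _ - _ = a * (x - (b + 1) / (2 * a)) ^+ 2); last first.
  by field; rewrite gt_eqF.
by rewrite mulr_ge0 ?sqr_ge0// ltW.
Qed.

Lemma integrable_gauss_bound f a b C : 0 < a ->
  measurable_fun (`]0, +oo[ : set R) f ->
  (forall x, 0 < x -> `|f x| <= C * expR (- (a * x ^+ 2) + b * x)) ->
  leb.-integrable `]0, +oo[ (EFin \o f).
Proof.
move=> a0 mf fC.
apply: (le_integrable _ _ _ (integrableZl _ (C * expR ((b + 1) ^+ 2 / (4 * a)))
  integrable_expRN)) => //; first exact/measurable_EFinP.
move=> x; rewrite /= in_itv/= andbT => x0.
rewrite lee_fin (le_trans (fC x x0))// (le_trans _ (ler_norm _))//.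
(* A negative [C] contradicts the bound, since |f x| is nonnegative. *)
have [C0|C0] := leP 0 C; first by rewrite -mulrA ler_wpM2l// gauss_le_expRN.
have := le_trans (normr_ge0 _) (fC x x0).
by rewrite pmulr_lge0 ?expR_gt0// leNgt C0.
Qed.

(** From ln x <= x. It brings power data under the exponential growth condition that the Gaussian
    bounds accept. *)
Lemma powR_le_expR p x : 0 <= p -> 0 < x -> x `^ p <= expR (p * x).
Proof.
move=> p0 x0; rewrite /powR gt_eqF// ler_expR ler_wpM2l//.
rewrite -[leRHS]expRK ler_ln ?posrE ?expR_gt0//.
by rewrite (le_trans _ (expR_ge1Dx x))// lerDr.
Qed.

Lemma le_expR x : x <= expR x.
Proof. by rewrite (le_trans _ (expR_ge1Dx x))// lerDr. Qed.

End Gaussian.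

(** * The Green function near the boundary *)

Section GreenQuotient.
Context {R : realType}.
Local Notation leb := (@lebesgue_measure R).
Implicit Types (f g F phi : R -> R) (s t x y a b C B xi : R).

Lemma green0 t xi tau : green 0 t xi tau = 0.
Proof. by rewrite /green oppr0 subrr. Qed.

Lemma heat_kernel_shift x t xi tau : heat_kernel x t xi tau = heat_kernel x (t - tau) xi 0.
Proof. by rewrite /heat_kernel subr0. Qed.

Lemma green_shift x t xi tau : green x t xi tau = green x (t - tau) xi 0.
Proof. by rewrite /green !(heat_kernel_shift _ t). Qed.

Lemma measurable_heat_kernel D x t tau :
  measurable_fun (D : set (measurableTypeR R)) (fun xi => heat_kernel x t xi tau).
Proof.
apply: measurable_funM => //; apply: measurable_continuous.
rewrite (_ : (fun _ => _) = fun y => expR (- ((y - x) ^+ 2 / (4 * (t - tau))))).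
  exact: continuous_gauss.
by apply/funext => y; rewrite -sqrrN opprB.
Qed.

Lemma measurable_green D x t tau :
  measurable_fun (D : set (measurableTypeR R)) (fun xi => green x t xi tau).
Proof. by apply: measurable_funB; exact: measurable_heat_kernel. Qed.

Lemma is_derive_green t xi x : 0 < t ->
  is_derive x 1 (fun y => green y t xi 0)
    ((2 * Num.sqrt (pi * t))^-1 * (
      (xi - x) / (2 * t) * expR (- ((x - xi) ^+ 2 / (4 * t)))
      + (xi + x) / (2 * t) * expR (- ((x + xi) ^+ 2 / (4 * t))))).
Proof.
move=> t0; have tn0 : t != 0 by rewrite gt_eqF.
have H1 := is_derive_gauss t xi x tn0.
have H2 := is_derive_gauss t (- xi) x tn0.
have := is_deriveZ (2 * Num.sqrt (pi * t))^-1 (is_deriveB H1 H2).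
rewrite (_ : _ \*: _ = fun y => green y t xi 0); last first.
  apply/funext => y; rewrite /green /heat_kernel subr0 -mulrBr.
  by rewrite (_ : (- y - xi) ^+ 2 = (y - - xi) ^+ 2)//; ring.
move=> /is_derive_eq; apply; rewrite (_ : x - - xi = x + xi); last by ring.
rewrite /GRing.scale/=; congr (_ * _).
by move: (expR _) (expR _) => e1 e2; field.
Qed.

(** A majorant uniform in |x| < 1, as differentiation under the integral requires. It holds because
    (x - xi)^2 - (xi^2 - 2 xi) = x^2 + 2 (1 - x) xi is nonnegative. *)
Let gaussE t x xi : 0 < t -> x ^+ 2 < 1 -> 0 < xi ->
  expR (- ((x - xi) ^+ 2 / (4 * t))) <=
  expR (- ((4 * t)^-1 * xi ^+ 2) + (2 * t)^-1 * xi).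
Proof.
move=> t0 x1 xi0; rewrite ler_expR -subr_ge0.
have xle1 : x <= 1 by rewrite leNgt; apply/negP => x1'; nra.
rewrite (_ : _ - _ = (x ^+ 2 + 2 * (1 - x) * xi) / (4 * t)); last first.
  by field; rewrite gt_eqF.
apply: divr_ge0; last by rewrite mulr_ge0// ltW.
by rewrite addr_ge0 ?sqr_ge0// !mulr_ge0 ?subr_ge0// ltW.
Qed.

Lemma integrable_volterra_kernel phi C B t : 0 < t -> 0 <= C ->
  measurable_fun (`]0, +oo[ : set R) phi ->
  (forall xi, 0 < xi -> `|phi xi| <= C * expR (B * xi)) ->
  leb.-integrable `]0, +oo[
    (EFin \o (fun xi => xi * expR (- (xi ^+ 2 / (4 * t))) * phi xi)).
Proof.
move=> t0 C0 mphi phiC.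
apply: (@integrable_gauss_bound R _ (4 * t)^-1 (B + 1) C).
- by rewrite invr_gt0 mulr_gt0.
- apply: measurable_funM => //; apply: measurable_funM => //.
  apply: measurableT_comp => //; apply: measurableT_comp => //.
  by apply: measurable_funM.
- move=> xi xi0; rewrite !normrM (gtr0_norm xi0) ger0_norm ?expR_ge0//.
  rewrite [(B + 1) * _]mulrDl mul1r addrA !expRD (mulrC _^-1).
  rewrite [leRHS](_ : _ = expR xi * expR (- (xi ^+ 2 / (4 * t))) * (C * expR (B * xi))).
    apply: ler_pM; rewrite ?phiC// ?mulr_ge0 ?expR_ge0 ?(ltW xi0)//.
    by rewrite ler_wpM2r ?expR_ge0 ?le_expR.
  by rewrite (mulrC (xi ^+ 2)); ring.
Qed.

(* The Green function vanishes at [x = 0], so this limit is the normal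
   derivative at the boundary of the Dirichlet heat flow started at [phi]. *)
Lemma cvg_green_quotient phi C B t : 0 < t -> 0 <= C ->
  measurable_fun (`]0, +oo[ : set R) phi ->
  (forall xi, 0 < xi -> `|phi xi| <= C * expR (B * xi)) ->
  x^-1 * \int[leb]_(xi in `]0, +oo[) (green x t xi 0 * phi xi) @[x --> 0^'+] -->
  volterra_kernel phi t.
Proof.
move=> t0 C0 mphi phiC.
pose k := (2 * Num.sqrt (pi * t))^-1.
have k0 : 0 < k by rewrite invr_gt0 mulr_gt0// sqrtr_gt0 mulr_gt0// pi_gt0.
pose f x xi := green x t xi 0 * phi xi.
pose E xi := expR (- ((4 * t)^-1 * xi ^+ 2) + (2 * t)^-1 * xi).
have df x xi : is_derive x 1 (f ^~ xi) (k * (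
      (xi - x) / (2 * t) * expR (- ((x - xi) ^+ 2 / (4 * t)))
      + (xi + x) / (2 * t) * expR (- ((x + xi) ^+ 2 / (4 * t)))) * phi xi).
  have := is_deriveZ (phi xi) (is_derive_green t xi x t0).
  rewrite (_ : _ \*: _ = f ^~ xi); last by apply/funext => y; exact: mulrC.
  by move=> /is_derive_eq; apply; exact: mulrC.
have E1 x xi : x ^+ 2 < 1 -> 0 < xi -> expR (- ((x - xi) ^+ 2 / (4 * t))) <= E xi.
  exact: gaussE.
have E2 x xi : x ^+ 2 < 1 -> 0 < xi -> expR (- ((x + xi) ^+ 2 / (4 * t))) <= E xi.
  move=> x1 xi0; rewrite -sqrrN opprD; apply: E1 => //; by rewrite sqrrN.
have I1 x : -1 < x < 1 -> x ^+ 2 < 1 by move=> /andP[? ?]; nra.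
have mf x : measurable_fun (`]0, +oo[ : set R) (f x).
  by apply: measurable_funM => //; exact: measurable_green.
have intf x : (`]-1, 1[ : set R) x -> leb.-integrable `]0, +oo[ (EFin \o f x).
  rewrite /= in_itv/= => x1.
  apply: (@integrable_gauss_bound R (f x) (4 * t)^-1 ((2 * t)^-1 + B) (2 * k * C)) => //.
    by rewrite invr_gt0 mulr_gt0.
  move=> xi xi0; rewrite [(_ + B) * _]mulrDl addrA expRD -/(E xi).
  rewrite (_ : 2 * k * C * _ = 2 * k * E xi * (C * expR (B * xi))); last by ring.
  rewrite normrM.
  apply: ler_pM => //; last exact: phiC.
  rewrite /green /heat_kernel subr0 -/k (le_trans (ler_normB _ _))//.
  rewrite !ger0_norm ?mulr_ge0 ?expR_ge0 ?(ltW k0)//.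
  rewrite -mulrA [2 * _]mulrDl mul1r lerD// ler_wpM2l ?(ltW k0)//.
    by apply: E1 => //; exact: I1.
  by apply: gaussE => //; rewrite sqrrN; exact: I1.
(* Majorant of the x-derivative: |xi - x| and |xi + x| are at most 1 + xi <= exp xi, which adds 1 to
   the linear rate, and the two summands with factor 1/(2t) add up to 1/t. *)
pose G xi := k / t * C * expR (- ((4 * t)^-1 * xi ^+ 2) + ((2 * t)^-1 + B + 1) * xi).
have G_ge0 xi : 0 <= G xi.
  by rewrite !mulr_ge0 ?expR_ge0 ?invr_ge0 ?(ltW k0) ?(ltW t0).
have GE xi : G xi = k * (expR xi / t * E xi) * (C * expR (B * xi)).
  rewrite /G [in LHS](_ : _ + _ = (- ((4 * t)^-1 * xi ^+ 2) + (2 * t)^-1 * xi)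
    + B * xi + xi); last by rewrite [(_ + 1) * _]mulrDl [(_ + B) * _]mulrDl mul1r !addrA.
  rewrite 2!expRD -/(E xi); move: (E xi) (expR (B * xi)) (expR xi) => e1 e2 e3.
  by field; rewrite gt_eqF.
have intG : leb.-integrable `]0, +oo[ (EFin \o G).
  apply: (@integrable_gauss_bound R G (4 * t)^-1 ((2 * t)^-1 + B + 1) (k / t * C)) => //.
  - by rewrite invr_gt0 mulr_gt0.
  - apply: measurable_funM => //; apply: measurableT_comp => //.
    apply: measurable_funD; last exact: measurable_funM.
    apply: measurableT_comp => //; exact: measurable_funM.
  - by move=> xi xi0; rewrite ger0_norm.
have Gub x xi : (`]-1, 1[ : set R) x -> (`]0, +oo[ : set R) xi ->
    `|partial1of2 f x xi| <= G xi.
  rewrite /= !in_itv/= andbT => x1 xi0; rewrite partial1of2E GE.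
  have dfx := df x xi; rewrite derive_val normrM; apply: ler_pM => //; last exact: phiC.
  rewrite normrM (gtr0_norm k0) ler_wpM2l ?(ltW k0)//.
  rewrite (le_trans (ler_normD _ _))// !normrM !(ger0_norm (expR_ge0 _)).
  have b y : `|y| <= 1 + xi -> `|y| * `|(2 * t)^-1| <= expR xi / (2 * t).
    move=> yxi; rewrite [X in _ * X]gtr0_norm ?invr_gt0 ?mulr_gt0//.
    by rewrite ler_wpM2r ?invr_ge0 ?mulr_ge0 ?(ltW t0)// (le_trans yxi)// expR_ge1Dx.
  have -> : expR xi / t * E xi = expR xi / (2 * t) * E xi + expR xi / (2 * t) * E xi.
    by field; rewrite gt_eqF.
  apply: lerD; apply: ler_pM; rewrite ?mulr_ge0 ?expR_ge0//.
  - by apply: b; rewrite ler_norml; apply/andP; split; case/andP: x1 => ? ?; lra.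
  - by apply: E1 => //; exact: I1.
  - by apply: b; rewrite ler_norml; apply/andP; split; case/andP: x1 => ? ?; lra.
  - by apply: E2 => //; exact: I1.
(* At x = 0 the two Gaussian terms of the derivative coincide, which doubles 1/(2t) and gives the
   integrand of the kernel. *)
have -> : volterra_kernel phi t = \int[leb]_(xi in `]0, +oo[) partial1of2 f 0 xi.
  rewrite /volterra_kernel -RintegralZl//; last first.
    exact: integrable_volterra_kernel t0 C0 mphi phiC.
  have t32 : t `^ (3 / 2) = t * Num.sqrt t.
    rewrite (_ : 3 / 2 = 1 + 2^-1); last by field.
    by rewrite powRD ?powRr1 ?powR12_sqrt ?ltW// (gt_eqF t0) implybT.
  have -> : (2 * Num.sqrt pi * t `^ (3 / 2))^-1 = k / t.
    by rewrite /k sqrtrM ?pi_ge0// t32; field; rewrite !gt_eqF// ?sqrtr_gt0 ?pi_gt0.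
  apply: eq_Rintegral => xi _; rewrite partial1of2E.
  have dfx := df 0 xi; rewrite derive_val.
  rewrite !(subr0, addr0, add0r, sub0r) sqrrN; move: (expR _) => e.
  by field; rewrite gt_eqF.
have derf x xi : (`]-1, 1[ : set R) x -> (`]0, +oo[ : set R) xi ->
    derivable (f ^~ xi) x 1.
  by move=> _ _; have := df x xi => ?; exact: ex_derive.
have I0 : (`]-1, 1[ : set R) 0 by rewrite /= in_itv/= ltrN10 ltr01.
have := @cvg_differentiation_under_integral R _ _ leb f `]0, +oo[
  (measurable_itv _) 0 (-1) 1 I0 intf derf G G_ge0 intG Gub.
move=> /cvg_dnbhs_at_right.
apply: cvg_trans; apply: near_eq_cvg; near=> x.
rewrite addr0 [X in _ - X](_ : _ = 0) ?subr0//.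
rewrite (_ : (fun xi => f 0 xi) = cst 0) ?Rintegral_cst ?mul0r//.
by apply/funext => xi; rewrite /f green0 mul0r.
Unshelve. all: by end_near. Qed.

End GreenQuotient.

(** * Fourier transform of the heat kernel *)

Section GaussianFourier.
Context {R : realType}.
Local Notation leb := (@lebesgue_measure R).
Implicit Types (f g F phi : R -> R) (s t x y a b C B xi l th : R).

Lemma heat_kernel_ge0 x t xi tau : 0 <= heat_kernel x t xi tau.
Proof. by rewrite mulr_ge0 ?expR_ge0// invr_ge0 mulr_ge0. Qed.

(** In [xi] the heat kernel is the normal density of mean [x] and variance 2s; integrability and
    total mass 1 follow. *)
Lemma heat_kernel_normal_pdf x s xi : 0 < s ->
  heat_kernel x s xi 0 = normal_pdf x (Num.sqrt (2 * s)) xi.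
Proof.
move=> s0; have s2 : Num.sqrt (2 * s) ^+ 2 = 2 * s.
  by rewrite sqr_sqrtr// mulr_ge0// ltW.
rewrite normal_pdfE; last by rewrite gt_eqF// sqrtr_gt0 mulr_gt0.
rewrite /heat_kernel /normal_peak /normal_fun s2 subr0; congr (_^-1 * expR _).
  rewrite (_ : 2 * s * pi *+ 2 = 2 ^+ 2 * (pi * s)); last by rewrite -mulr_natr; ring.
  by rewrite [in RHS]sqrtrM ?sqr_ge0// sqrtr_sqr ger0_norm.
rewrite mulNr; congr (- (_ / _)); last by rewrite -mulr_natr; ring.
by rewrite -sqrrN opprB.
Qed.

Lemma integrable_heat_kernel x s : 0 < s ->
  leb.-integrable setT (EFin \o (fun xi => heat_kernel x s xi 0)).
Proof.
move=> s0; apply: eq_integrable (integrable_normal_pdf x (Num.sqrt (2 * s))) => //.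
by move=> xi _; rewrite /= heat_kernel_normal_pdf.
Qed.

Lemma Rintegral_heat_kernel x s : 0 < s -> \int[leb]_xi heat_kernel x s xi 0 = 1.
Proof.
move=> s0; rewrite /Rintegral.
under eq_integral do rewrite heat_kernel_normal_pdf//.
by rewrite integral_normal_pdf.
Qed.

(* Half of the Gaussian decay absorbs the polynomial factor. *)
Lemma moment_heat_kernel_le x s xi : 0 < s ->
  `|(xi - x) * heat_kernel x s xi 0| <=
  (4 * s + 1) * Num.sqrt 2 * heat_kernel x (2 * s) xi 0.
Proof.
move=> s0; rewrite /heat_kernel !subr0 -(sqrrN (x - xi)) opprB.
set y := xi - x; set e := expR (- (y ^+ 2 / (4 * (2 * s)))).
have -> : expR (- (y ^+ 2 / (4 * s))) = e * e.
  by rewrite -expRD; congr expR; field; rewrite gt_eqF.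
have -> : Num.sqrt (pi * (2 * s)) = Num.sqrt 2 * Num.sqrt (pi * s) :> R.
  by rewrite (mulrCA pi) sqrtrM.
have r2 : Num.sqrt 2 != 0 :> R by rewrite gt_eqF// sqrtr_gt0.
have rs : Num.sqrt (pi * s) != 0 by rewrite gt_eqF// sqrtr_gt0 mulr_gt0// pi_gt0.
set k := (2 * Num.sqrt (pi * s))^-1.
rewrite [X in `|X|](_ : _ = k * e * (y * e)); last by ring.
rewrite [leRHS](_ : _ = k * e * (4 * s + 1)); last first.
  by rewrite /k; field; rewrite rs r2.
have k0 : 0 <= k * e by rewrite mulr_ge0 ?expR_ge0 ?invr_ge0 ?mulr_ge0.
rewrite normrM ger0_norm// ler_wpM2l// normrM [X in _ * X]ger0_norm ?expR_ge0//.
rewrite /e expRN ler_pdivrMr ?expR_gt0//.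
(* After 1 + z <= exp z, the summand 4s of the constant cancels the denominator 8s and leaves 1 +
   y^2/2, which exceeds |y|. *)
apply: (@le_trans _ _ ((4 * s + 1) * (1 + y ^+ 2 / (4 * (2 * s))))); last first.
  by rewrite ler_wpM2l ?expR_ge1Dx// addr_ge0// mulr_ge0// ltW.
rewrite [leRHS](_ : _ = (1 + y ^+ 2 / 2) + (4 * s + y ^+ 2 / (4 * (2 * s)))); last first.
  by field; rewrite gt_eqF.
rewrite ler_wpDr//.
  by rewrite addr_ge0 ?divr_ge0 ?sqr_ge0 ?mulr_ge0// ltW.
rewrite -(real_normK (num_real y)) -subr_ge0.
rewrite (_ : _ - _ = (1 + (`|y| - 1) ^+ 2) / 2); last by field.
by rewrite divr_ge0// addr_ge0// sqr_ge0.
Qed.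

Lemma integrable_moment_heat_kernel x s g : 0 < s ->
  measurable_fun setT g -> (forall xi, `|g xi| <= 1) ->
  leb.-integrable setT (EFin \o (fun xi => (xi - x) * heat_kernel x s xi 0 * g xi)).
Proof.
move=> s0 mg g1.
have s20 : 0 < 2 * s by rewrite mulr_gt0.
apply: (le_integrable _ _ _
  (integrableZl _ ((4 * s + 1) * Num.sqrt 2) (integrable_heat_kernel x (2 * s) s20))) => //.
  apply/measurable_EFinP; apply: measurable_funM => //.
  apply: measurable_funM; last exact: measurable_heat_kernel.
  exact: measurable_funB.
move=> xi _; rewrite lee_fin/= normrM.
rewrite (le_trans _ (ler_norm _))// (le_trans _ (moment_heat_kernel_le x s xi s0))//.
by rewrite ler_piMr.
Qed.

Lemma cvg_heat_kernel_pinfty x s : 0 < s ->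
  heat_kernel x s xi 0 @[xi --> +oo] --> (0 : R).
Proof.
move=> s0; rewrite /heat_kernel subr0.
rewrite -[X in _ --> X](mulr0 (2 * Num.sqrt (pi * s))^-1); apply: cvgMr.
pose a := (4 * s)^-1; pose b := (2 * s)^-1 * x.
have a0 : 0 < a by rewrite invr_gt0 mulr_gt0.
pose K := expR (- (x ^+ 2 / (4 * s))) * expR ((b + 1) ^+ 2 / (4 * a)).
have KE : K * expR (- xi) @[xi --> +oo] --> (0 : R).
  by rewrite -(mulr0 K); apply: cvgMr; exact: cvgr_expR.
apply: squeeze_cvgr KE; last exact: cvg_cst.
apply: nearW => xi; rewrite expR_ge0/=.
have := ler_wpM2l (expR_ge0 (- (x ^+ 2 / (4 * s)))) (gauss_le_expRN a b xi a0).
rewrite [leRHS]mulrA -/K; apply: le_trans.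
rewrite -expRD ler_expR le_eqVlt; apply/orP; left; apply/eqP.
by rewrite /a /b; field; rewrite gt_eqF.
Qed.

Lemma cvg_heat_kernel_ninfty x s : 0 < s ->
  heat_kernel x s xi 0 @[xi --> -oo] --> (0 : R).
Proof.
move=> s0; apply/cvgNy_compNP.
rewrite (_ : _ \o _ = fun xi => heat_kernel (- x) s xi 0).
  exact: cvg_heat_kernel_pinfty.
apply/funext => xi; rewrite /= /heat_kernel.
by rewrite (_ : (x - - xi) ^+ 2 = (- x - xi) ^+ 2)//; ring.
Qed.

(** The phase is centred at [x] so that the derivative in [l] brings out xi - x, the same factor
    that the derivative of the kernel in [xi] brings out. The free shift [th] lets cosines represent
    sine data. *)
Let wave x s th l xi := heat_kernel x s xi 0 * cos (l * (xi - x) + th).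

Let measurable_phase x th l (D : set (measurableTypeR R)) :
  measurable_fun D (fun xi => l * (xi - x) + th).
Proof.
by apply: measurable_funD => //; apply: measurable_funM => //; exact: measurable_funB.
Qed.

Lemma measurable_sin (D : set (measurableTypeR R)) : measurable_fun D (@sin R).
Proof. by apply: measurable_continuous; exact: continuous_sin. Qed.

Lemma measurable_cos (D : set (measurableTypeR R)) : measurable_fun D (@cos R).
Proof. by apply: measurable_continuous; exact: continuous_cos. Qed.

Lemma norm_sin_le1 x : `|sin x| <= 1.
Proof. by rewrite ler_norml sin_geN1 sin_le1. Qed.

Lemma norm_cos_le1 x : `|cos x| <= 1.
Proof. by rewrite ler_norml cos_geN1 cos_le1. Qed.

Lemma integrable_heat_kernelMr x s g : 0 < s ->
  measurable_fun setT g -> (forall xi, `|g xi| <= 1) ->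
  leb.-integrable setT (EFin \o (fun xi => heat_kernel x s xi 0 * g xi)).
Proof.
move=> s0 mg g1; apply: (le_integrable _ _ _ (integrable_heat_kernel x s s0)) => //.
  by apply/measurable_EFinP; apply: measurable_funM => //; exact: measurable_heat_kernel.
move=> xi _; rewrite lee_fin/= normrM ler_piMr//.
Qed.

Let integrable_wave x s th l : 0 < s -> leb.-integrable setT (EFin \o wave x s th l).
Proof.
move=> s0; apply: integrable_heat_kernelMr => // [|xi]; last exact: norm_cos_le1.
apply: measurableT_comp; [exact: measurable_cos|exact: measurable_phase].
Qed.

Let dwave x s th l xi : is_derive l 1 (fun l => wave x s th l xi)
  (- ((xi - x) * heat_kernel x s xi 0 * sin (l * (xi - x) + th))).
Proof.
have H : is_derive l 1 (fun l => l * (xi - x) + th) (xi - x).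
  have := is_deriveD (is_deriveZ (xi - x) (is_derive_id l 1)) (is_derive_cst th l 1).
  rewrite (_ : _ + _ = fun l => l * (xi - x) + th).
    by move=> /is_derive_eq; apply; rewrite addr0 [LHS]mulr1.
  by apply/funext => y; rewrite !fctE; congr (_ + _); exact: mulrC.
have := is_deriveZ (heat_kernel x s xi 0) (is_derive1_comp (is_derive_cos _) H).
by move=> /is_derive_eq; apply; rewrite /GRing.scale/=; ring.
Qed.

(** Integration by parts: the function [F], kernel times sine, vanishes at both infinities, so its
    derivative [f] has integral zero. This is what closes the ODE in [l] below. *)
Let moment_wave x s th l : 0 < s ->
  \int[leb]_xi ((xi - x) * heat_kernel x s xi 0 * sin (l * (xi - x) + th)) =
  2 * s * l * \int[leb]_xi wave x s th l xi.
Proof.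
move=> s0; have sn0 : s != 0 by rewrite gt_eqF.
pose M xi := (xi - x) * heat_kernel x s xi 0 * sin (l * (xi - x) + th).
pose F xi := heat_kernel x s xi 0 * sin (l * (xi - x) + th).
pose f xi := - (2 * s)^-1 * M xi + l * wave x s th l xi.
have dphase xi : is_derive xi 1 (fun xi => l * (xi - x) + th) l.
  have := is_deriveD (is_deriveZ l (is_derive_shift xi 1 (- x))) (is_derive_cst th xi 1).
  by move=> /is_derive_eq; apply; rewrite addr0 [LHS]mulr1.
have cphase : continuous (fun xi => l * (xi - x) + th).
  move=> xi; apply/differentiable_continuous/derivable1_diffP.
  have := dphase xi => ?; exact: ex_derive.
have dheat xi : is_derive xi 1 (fun xi => heat_kernel x s xi 0)
    (- ((xi - x) / (2 * s)) * heat_kernel x s xi 0).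
  have := is_deriveZ (2 * Num.sqrt (pi * s))^-1 (is_derive_gauss s x xi sn0).
  rewrite (_ : _ \*: _ = fun xi => heat_kernel x s xi 0); last first.
    apply/funext => y; rewrite /heat_kernel subr0 -(sqrrN (x - y)) opprB.
    by [].
  move=> /is_derive_eq; apply; rewrite /heat_kernel subr0 -(sqrrN (x - xi)) opprB.
  by rewrite /GRing.scale/= mulrCA.
have cheat : continuous (fun xi => heat_kernel x s xi 0).
  move=> xi; apply/differentiable_continuous/derivable1_diffP.
  have := dheat xi => ?; exact: ex_derive.
have cM : continuous M.
  move=> xi; apply: cvgM; first apply: cvgM.
  - by apply: cvgB; [exact: cvg_id|exact: cvg_cst].
  - exact: cheat.
  - by apply: continuous_comp; [exact: cphase|exact: continuous_sin].
have cw : continuous (wave x s th l).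
  move=> xi; apply: cvgM; first exact: cheat.
  by apply: continuous_comp; [exact: cphase|exact: continuous_cos].
have intM : leb.-integrable setT (EFin \o M).
  apply: integrable_moment_heat_kernel => // [|xi]; last exact: norm_sin_le1.
  apply: measurableT_comp; [exact: measurable_sin|exact: measurable_phase].
have int1 : leb.-integrable setT (EFin \o (fun xi => - (2 * s)^-1 * M xi)).
  exact: (integrableZl _ (- (2 * s)^-1) intM).
have int2 : leb.-integrable setT (EFin \o (fun xi => l * wave x s th l xi)).
  exact: (integrableZl _ l (integrable_wave x s th l s0)).
have Fle xi : - heat_kernel x s xi 0 <= F xi <= heat_kernel x s xi 0.
  rewrite -ler_norml normrM [`|heat_kernel _ _ _ _|]ger0_norm ?heat_kernel_ge0//.
  by rewrite ler_piMr ?norm_sin_le1 ?heat_kernel_ge0.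
have Fcvg (A : set_system R) : Filter A ->
    heat_kernel x s xi 0 @[xi --> A] --> (0 : R) -> F xi @[xi --> A] --> (0 : R).
  move=> FA h0; have Nh0 : - heat_kernel x s xi 0 @[xi --> A] --> (0 : R).
    by rewrite -[X in _ --> X]oppr0; exact: cvgN.
  by apply: squeeze_cvgr Nh0 h0; apply: nearW => xi; exact: Fle.
have : \int[leb]_xi f xi = 0 - 0.
  apply: (@Rintegral_T_FTC R f F).
  - exact: (integrableD measurableT int1 int2).
  - by move=> xi; apply: cvgD; apply: cvgMr; [exact: cM|exact: cw].
  - move=> xi.
    have := is_deriveM (dheat xi) (is_derive1_comp (is_derive_sin _) (dphase xi)).
    move=> /is_derive_eq; apply; rewrite /f /M /wave /GRing.scale/=; field.
    by [].
  - by apply: Fcvg; exact: cvg_heat_kernel_ninfty.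
  - by apply: Fcvg; exact: cvg_heat_kernel_pinfty.
rewrite subr0 RintegralD// !RintegralZl//; last exact: integrable_wave.
rewrite -/M; move: (\int[leb]_xi M xi) (\int[leb]_xi wave x s th l xi) => I W.
move=> /eqP; rewrite mulNr addrC subr_eq0 => /eqP IW.
by rewrite -[RHS]mulrA IW; field.
Qed.

(** As a function of the frequency, the integral [J] solves J' = - 2 s l J with J(0) = cos th, the
    kernel having mass 1. *)
Lemma heat_kernel_fourier x s th l : 0 < s ->
  \int[leb]_xi (heat_kernel x s xi 0 * cos (l * (xi - x) + th)) =
  cos th * expR (- (l ^+ 2 * s)).
Proof.
move=> s0; pose J l := \int[leb]_xi wave x s th l xi.
have dJ y : is_derive y 1 J (- (2 * s * y * J y)).
  pose G xi := `|(xi - x) * heat_kernel x s xi 0|.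
  have G_ge0 xi : 0 <= G xi by exact: normr_ge0.
  have intG : leb.-integrable setT (EFin \o G).
    have cst1 xi : `|(cst 1 : R -> R) xi| <= 1 by rewrite normr1.
    have := integrable_moment_heat_kernel x s (cst 1) s0 (measurable_cst _) cst1.
    move=> /integrable_norm; rewrite (_ : _ \o _ = EFin \o G)//.
    by apply/funext => xi; rewrite /= mulr1.
  have Iy : (`]y - 1, y + 1[ : set R) y by rewrite /= in_itv/= gtrBl ltrDl ltr01.
  have intw z : (`]y - 1, y + 1[ : set R) z -> leb.-integrable setT (EFin \o wave x s th z).
    by move=> _; exact: integrable_wave.
  have dw z xi : (`]y - 1, y + 1[ : set R) z -> [set: R] xi ->
      derivable ((wave x s th) ^~ xi) z 1.
    by move=> _ _; have := dwave x s th z xi => ?; exact: ex_derive.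
  have Gub z xi : (`]y - 1, y + 1[ : set R) z -> [set: R] xi ->
      `|partial1of2 (wave x s th) z xi| <= G xi.
    move=> _ _; rewrite partial1of2E; have dz := dwave x s th z xi.
    by rewrite derive_val normrN normrM ler_piMr// norm_sin_le1.
  have J1 := @derivable_under_integral R _ _ leb _ _ measurableT _ _ _
    Iy intw dw G G_ge0 intG Gub.
  have J2 := @differentiation_under_integral R _ _ leb _ _ measurableT _ _ _
    Iy intw dw G G_ge0 intG Gub.
  apply: (DeriveDef J1); rewrite -derive1E J2 -moment_wave//.
  rewrite -[RHS]mulN1r -RintegralZl//; last first.
    apply: integrable_moment_heat_kernel => // [|xi]; last exact: norm_sin_le1.
    apply: measurableT_comp; [exact: measurable_sin|exact: measurable_phase].
  apply: eq_Rintegral => xi _; rewrite partial1of2E; have dz := dwave x s th y xi.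
  by rewrite derive_val mulN1r.
(* The integrating factor of the ODE: [H] has zero derivative, so its value at [l] is the one at
   0. *)
pose H y := J y * expR (s * y ^+ 2).
have dH y : is_derive y 1 H 0.
  have d2 : is_derive y 1 (fun y => s * y ^+ 2) (2 * s * y).
    have := is_deriveZ s (is_deriveX 2 (is_derive_id y 1)).
    by move=> /is_derive_eq; apply; rewrite /GRing.scale/= expr1; ring.
  have := is_deriveM (dJ y) (is_derive_expR_comp _ _ _ d2).
  by move=> /is_derive_eq; apply; rewrite /GRing.scale/=; ring.
have := @is_derive_0_is_cst R H l 0 dH.
rewrite /H expr0n/= mulr0 expR0 mulr1.
have -> : J 0 = cos th.
  rewrite /J /wave; under eq_Rintegral do rewrite mul0r add0r mulrC.
  rewrite RintegralZl ?Rintegral_heat_kernel ?mulr1//.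
  exact: integrable_heat_kernel.
move=> <-; rewrite -mulrA -expRD (_ : _ + _ = 0) ?expR0 ?mulr1//.
by ring.
Qed.

End GaussianFourier.

(** * Sine data *)

Section GreenSine.
Context {R : realType}.
Local Notation leb := (@lebesgue_measure R).
Implicit Types (f g F phi Phi : R -> R) (s t x y a b C B xi l th : R).

(** Lets an integral of the Green function over the half-line be unfolded into one of the heat
    kernel over the whole line. The reflection is a pushforward that preserves Lebesgue measure. *)
Lemma Rintegral_fold g :
  leb.-integrable setT (EFin \o g) ->
  \int[leb]_xi g xi =
    \int[leb]_(xi in `]0, +oo[) g xi + \int[leb]_(xi in `]0, +oo[) g (- xi).
Proof.
move=> intg; have mg : measurable_fun (setT : set (measurableTypeR R)) (EFin \o g).
  exact: measurable_int intg.
have mopp : measurable_fun setT (-%R : measurableTypeR R -> measurableTypeR R).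
  exact: measurable_continuous opp_continuous.
have mgN : measurable_fun (setT : set (measurableTypeR R)) (EFin \o (g \o -%R)).
  exact: (measurableT_comp mg mopp).
have preE : (-%R : measurableTypeR R -> measurableTypeR R) @^-1` `]0, +oo[ = `]-oo, 0[.
  by rewrite opp_preimage_itvbndy oppr0.
have intgN : leb.-integrable
    ((-%R : measurableTypeR R -> measurableTypeR R) @^-1` `]0, +oo[)
    ((EFin \o (g \o -%R)) \o (-%R : measurableTypeR R -> measurableTypeR R)).
  rewrite preE (_ : _ \o _ = EFin \o g); last first.
    by apply/funext => xi; rewrite /= opprK.
  exact: integrableS intg.
have pushE (A : set (measurableTypeR R)) : measurable A -> A `<=` `]0, +oo[ ->
    leb A = pushforward leb (-%R : measurableTypeR R -> measurableTypeR R) A.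
  by move=> mA _; rewrite lebesgue_measureN.
have intN : \int[leb]_(xi in `]0, +oo[) g (- xi) = \int[leb]_(xi in `]-oo, 0[) g xi.
  rewrite /Rintegral; congr fine.
  rewrite (eq_measure_integral (pushforward leb
    (-%R : measurableTypeR R -> measurableTypeR R))); last exact: pushE.
  rewrite (integral_pushforward mopp mgN intgN)// preE.
  by apply: eq_integral => xi _; rewrite /= opprK.
rewrite intN addrC -[in LHS](setUv (`]-oo, 0[ : set R)) setCitvl.
rewrite Rintegral_setU//=.
- by congr (_ + _); rewrite Rintegral_itv_obnd_cbnd//; exact: integrableS intg.
- by rewrite -setCitvl setUv.
- by rewrite -setCitvl; apply/disj_setPCl.
Qed.

(** Method of images: sine is its own odd extension, so the reflected half of the kernel integral
    supplies exactly the subtracted term of the Green function, and the Fourier formula applies on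
    the whole line. *)
Lemma Rintegral_green_sin Phi a l x t tau : tau < t ->
  (forall xi, 0 < xi -> Phi xi = a * sin (l * xi)) ->
  \int[leb]_(xi in `]0, +oo[) (green x t xi tau * Phi xi) =
  a * sin (l * x) * expR (- (l ^+ 2 * (t - tau))).
Proof.
move=> taut PhiE; have s0 : 0 < t - tau by rewrite subr_gt0.
(* The shift l x - pi/2 turns the centred cosine into sin (l xi). *)
pose g xi := heat_kernel x (t - tau) xi 0 * cos (l * (xi - x) + (l * x - pi / 2)).
have gE xi : g xi = heat_kernel x (t - tau) xi 0 * sin (l * xi).
  by rewrite /g -cosBpihalf; congr (_ * cos _); ring.
have intg : leb.-integrable setT (EFin \o g).
  apply: integrable_heat_kernelMr => // [|xi]; last exact: norm_cos_le1.
  apply: measurableT_comp; first exact: measurable_cos.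
  by apply: measurable_funD => //; apply: measurable_funM => //; exact: measurable_funB.
have Eg := Rintegral_fold g intg.
have gNE xi : g (- xi) = - (heat_kernel (- x) (t - tau) xi 0 * sin (l * xi)).
  rewrite gE mulrN sinN mulrN /heat_kernel.
  by rewrite (_ : (x - - xi) ^+ 2 = (- x - xi) ^+ 2)//; ring.
have intgN : leb.-integrable `]0, +oo[ (EFin \o (fun xi => g (- xi))).
  suff : leb.-integrable setT
      (EFin \o (fun xi => heat_kernel (- x) (t - tau) xi 0 * - sin (l * xi))).
    rewrite (_ : EFin \o _ = EFin \o (fun xi => g (- xi))); last first.
      by apply/funext => xi; rewrite /= gNE mulrN.
    by apply: integrableS.
  apply: integrable_heat_kernelMr => // [|xi]; last by rewrite normrN norm_sin_le1.
  apply: measurableT_comp => //; apply: measurableT_comp; first exact: measurable_sin.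
  exact: measurable_funM.
have int0 : leb.-integrable `]0, +oo[ (EFin \o g) by exact: integrableS intg.
transitivity (\int[leb]_(xi in `]0, +oo[) (a * (g xi + g (- xi)))).
  apply: eq_Rintegral => xi; rewrite inE/= in_itv/= andbT => xi0.
  by rewrite PhiE// green_shift /green gNE gE; ring.
rewrite RintegralZl//; last first.
  exact: (@integrableD _ _ _ leb `]0, +oo[ (measurable_itv _) _ _ int0 intgN).
rewrite RintegralD// -Eg /g heat_kernel_fourier// cosBpihalf.
by rewrite mulrA.
Qed.

Lemma cvg_sin_quotient l : x^-1 * sin (l * x) @[x --> (0 : R)^'+] --> l.
Proof.
have ds : is_derive (0 : R) 1 (fun x => sin (l * x)) l.
  have := is_derive1_comp (is_derive_sin (l * 0)) (is_deriveZ l (is_derive_id (0 : R) 1)).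
  by move=> /is_derive_eq; apply; rewrite mulr0 cos0 mul1r [LHS]mulr1.
have /cvg_ex[/= q qE] := @ex_derive _ _ _ _ _ _ _ ds.
have ql : q = l by rewrite -(@derive_val _ _ _ _ _ _ _ ds); apply/esym/cvg_lim.
move: qE; rewrite ql => /cvg_dnbhs_at_right.
apply: cvg_trans; apply: near_eq_cvg; apply: nearW => x /=.
by rewrite addr0 mulr0 sin0 subr0 [x *: 1]mulr1.
Qed.

(** Uniqueness of limits: the boundary quotient of the flow of [Phi] tends to its Volterra kernel,
    while the flow itself is explicit and its quotient reduces to sin (l x) / x. *)
Lemma volterra_kernel_sin Phi a l t : 0 < t ->
  (forall xi, 0 < xi -> Phi xi = a * sin (l * xi)) ->
  volterra_kernel Phi t = a * l * expR (- (l ^+ 2 * t)).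
Proof.
move=> t0 PhiE.
have mPhi : measurable_fun (`]0, +oo[ : set R) Phi.
  apply: (@eq_measurable_fun _ _ _ _ _ (fun xi => a * sin (l * xi))).
    by move=> xi; rewrite inE/= in_itv/= andbT => xi0; rewrite PhiE.
  apply: measurable_funM => //; apply: measurableT_comp; first exact: measurable_sin.
  exact: measurable_funM.
have Phib xi : 0 < xi -> `|Phi xi| <= `|a| * expR (0 * xi).
  by move=> xi0; rewrite PhiE// mul0r expR0 normrM ler_wpM2l ?norm_sin_le1.
have h := @cvg_green_quotient R Phi `|a| 0 t t0 (normr_ge0 _) mPhi Phib.
have h2 : x^-1 * (a * sin (l * x) * expR (- (l ^+ 2 * t))) @[x --> (0:R)^'+] -->
    a * l * expR (- (l ^+ 2 * t)).
  have : a * expR (- (l ^+ 2 * t)) * (x^-1 * sin (l * x)) @[x --> (0 : R)^'+] -->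
      a * expR (- (l ^+ 2 * t)) * l by apply: cvgMr; exact: cvg_sin_quotient.
  rewrite (_ : a * expR _ * l = a * l * expR (- (l ^+ 2 * t))); last by ring.
  by apply: cvg_trans; apply: near_eq_cvg; apply: nearW => x /=; ring.
apply: (cvg_unique _ h) => //.
apply: cvg_trans h2; apply: near_eq_cvg; apply: nearW => x.
by rewrite (Rintegral_green_sin _ a l)// subr0.
Qed.

End GreenSine.

(** * Gaussian moments and the Gamma function *)

Section GaussianMoments.
Context {R : realType}.
Local Notation leb := (@lebesgue_measure R).
Implicit Types (f g G F phi Phi h : R -> R) (s t x y a b C B xi l th m p k eta : R).

Lemma continuous_powR p x : 0 < x -> {for x, continuous (fun y => y `^ p)}.
Proof.
move=> x0; apply/differentiable_continuous/derivable1_diffP.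
by have := is_derive1_powR p x0 => ?; exact: ex_derive.
Qed.

(** The substitution y = k xi^2 on compact segments, extended to the half-line by monotone
    convergence. With values in the extended reals, no finiteness has to be settled beforehand. *)
Lemma ge0_integral_sqr_substitution G k : 0 < k ->
  (forall y, 0 < y -> 0 <= G y) ->
  (forall y, 0 < y -> {for y, continuous G}) ->
  (\int[leb]_(y in `]0%R, +oo[) (G y)%:E =
   \int[leb]_(xi in `]0%R, +oo[) (G (k * xi ^+ 2) * (2 * k * xi))%:E)%E.
Proof.
move=> k0 G0 cG.
pose F xi := k * xi ^+ 2.
have dF xi : is_derive xi 1 F (2 * k * xi).
  have := is_deriveZ k (is_deriveX 2 (is_derive_id xi 1)).
  by move=> /is_derive_eq; apply; rewrite /GRing.scale/= expr1; ring.
have F'E : F^`() = fun xi => 2 * k * xi.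
  by apply/funext => xi; rewrite derive1E; have d := dF xi; rewrite derive_val.
have cF : continuous F.
  move=> xi; apply/differentiable_continuous/derivable1_diffP.
  by have := dF xi => ?; exact: ex_derive.
have cF' : continuous F^`().
  by rewrite F'E => xi; apply: cvgMr; exact: cvg_id.
have Fgt0 xi : 0 < xi -> 0 < F xi by move=> xi0; rewrite mulr_gt0// exprn_gt0.
have Fmono xi y : 0 < xi -> xi < y -> F xi < F y.
  by move=> xi0 xiy; rewrite ltr_pM2l// ltr_pXn2r// nnegrE ltW// (lt_trans xi0).
pose a n : R := n.+1%:R^-1; pose b n : R := n.+2%:R.
have a0 n : 0 < a n by rewrite invr_gt0.
have ab n : a n < b n.
  by rewrite (@le_lt_trans _ _ 1) ?ltr1n// invf_le1 ?ler1n.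
have na n j : (n <= j)%N -> a j <= a n.
  by move=> np; rewrite lef_pV2 ?posrE// ler_nat ltnS.
have nb n j : (n <= j)%N -> b n <= b j by move=> np; rewrite ler_nat.
have exn y : 0 < y -> exists n, a n <= y <= b n.
  move=> y0; have /(cvgr_le 0) ay : a n @[n --> \oo] --> (0 : R) by exact: cvg_harmonic.
  near \oo => n; exists n; apply/andP; split; first by near: n; exact: ay.
  rewrite (@le_trans _ _ n%:R) ?ler_nat//; last by rewrite -addn2 leq_addr.
  by near: n; exact: nbhs_infty_ger.
have a1 n : a n <= 1 by rewrite invf_le1 ?ler1n.
have b1 n : 1 <= b n by rewrite ler1n.
have DE : (`]0, +oo[ : set R) = \bigcup_n `[a n, b n].
  apply/seteqP; split => x; rewrite /= in_itv/= andbT.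
    by move=> /exn[n nx]; exists n => //=; rewrite in_itv.
  by move=> [n _]; rewrite /= in_itv/= => /andP[+ _]; exact: lt_le_trans.
have DE' : (`]0, +oo[ : set R) = \bigcup_n `[F (a n), F (b n)].
  apply/seteqP; split => x; rewrite /= in_itv/= andbT.
    (* Since a_n <= 1 <= b_n, squaring only widens the segment: one that contains x/k yields k a_n^2
       <= x <= k b_n^2. *)
    move=> x0; have xk0 : 0 < k^-1 * x by rewrite mulr_gt0 ?invr_gt0.
    have [n /andP[nx xn]] := exn _ xk0.
    exists n => //=; rewrite in_itv/=; apply/andP; split.
      rewrite -(mulVKf (lt0r_neq0 k0) x) ler_wpM2l ?(ltW k0)// (le_trans _ nx)//.
      by rewrite expr2 ler_piMl// ltW.
    rewrite -[leLHS](mulVKf (lt0r_neq0 k0) x) ler_wpM2l ?(ltW k0)// (le_trans xn)//.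
    by rewrite expr2 ler_peMl// ltW// (lt_le_trans _ (b1 n)).
  by move=> [n _]; rewrite /= in_itv/= => /andP[+ _]; apply: lt_le_trans; exact: Fgt0.
have mG : measurable_fun (`]0, +oo[ : set R) G.
  apply: open_continuous_measurable_fun => // x.
  by rewrite inE/= in_itv/= andbT; exact: cG.
have mGF : measurable_fun (`]0, +oo[ : set R) (fun xi => G (F xi) * (2 * k * xi)).
  apply: open_continuous_measurable_fun => // x.
  rewrite inE/= in_itv/= andbT => x0; apply: cvgM; last first.
    by apply: cvgMr; exact: cvg_id.
  by apply: continuous_comp; [exact: cF|exact/cG/Fgt0].
have h1 : (\int[leb]_(y in `[F (a n), F (b n)]) (G y)%:E @[n --> \oo] -->
    \int[leb]_(y in `]0%R, +oo[) (G y)%:E)%E.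
  rewrite DE'; apply: ge0_nondecreasing_set_cvg_integral => //.
  - move=> n p np; apply/subsetPset; apply: subset_itv; rewrite bnd_simp.
      by rewrite ler_pM2l// lerXn2r ?nnegrE ?(ltW (a0 _))// na.
    by rewrite ler_pM2l// lerXn2r ?nnegrE ?(le_trans ler01)// nb.
  - move=> n; apply/measurable_EFinP; apply: measurable_funS mG => // x.
    by rewrite /= !in_itv/= andbT => /andP[+ _]; apply: lt_le_trans; exact: Fgt0.
  - move=> n x; rewrite /= in_itv/= => /andP[+ _] => Fx.
    by rewrite lee_fin G0// (lt_le_trans _ Fx)// Fgt0.
have h2 : (\int[leb]_(xi in `[a n, b n]) (G (F xi) * (2 * k * xi))%:E @[n --> \oo] -->
    \int[leb]_(xi in `]0%R, +oo[) (G (F xi) * (2 * k * xi))%:E)%E.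
  rewrite DE; apply: ge0_nondecreasing_set_cvg_integral => //.
  - move=> n p np; apply/subsetPset; apply: subset_itv; rewrite bnd_simp.
      exact: na.
    exact: nb.
  - move=> n; apply/measurable_EFinP; apply: measurable_funS mGF => // x.
    by rewrite /= !in_itv/= andbT => /andP[+ _]; apply: lt_le_trans.
  - move=> n x; rewrite /= in_itv/= => /andP[+ _] => ax.
    have x0 : 0 < x by rewrite (lt_le_trans _ ax).
    by rewrite lee_fin !mulr_ge0 ?G0 ?Fgt0// ltW.
apply: (cvg_unique _ h1) => //.
apply: cvg_trans h2; apply: near_eq_cvg; apply: nearW => n.
rewrite integration_by_substitution_increasing.
- by apply: eq_integral => xi _; rewrite F'E.
- exact/ltW.
- move=> x y; rewrite !in_itv/= => /andP[ax _] _; apply: Fmono.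
  by rewrite (lt_le_trans _ ax).
- by move=> x _; exact: cF'.
- by apply/cvg_ex; exists (F^`() (a n)); apply: cvg_at_right_filter; exact: cF'.
- by apply/cvg_ex; exists (F^`() (b n)); apply: cvg_at_left_filter; exact: cF'.
- split.
  + by move=> x _; have := dF x => ?; exact: ex_derive.
  + by apply: cvg_at_right_filter; exact: cF.
  + by apply: cvg_at_left_filter; exact: cF.
- apply: continuous_in_subspaceT => x; rewrite inE/= in_itv/= => /andP[Fx _].
  by apply: cG; rewrite (lt_le_trans _ Fx)// Fgt0.
Unshelve. all: by end_near. Qed.

Lemma continuous_gauss0 t : continuous (fun y => expR (- (y ^+ 2 / (4 * t)))).
Proof.
rewrite (_ : (fun _ => _) = fun y => expR (- ((y - 0) ^+ 2 / (4 * t)))).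
  exact: continuous_gauss.
by apply/funext => y; rewrite subr0.
Qed.

Lemma powR_gauss_le p t x : 0 <= p -> 0 < x ->
  x `^ p * expR (- (x ^+ 2 / (4 * t))) <= expR (- ((4 * t)^-1 * x ^+ 2) + p * x).
Proof.
move=> p0 x0; rewrite expRD (mulrC _^-1) [leLHS]mulrC.
by rewrite ler_wpM2l ?expR_ge0// powR_le_expR.
Qed.

Lemma measurable_powR_gauss (D : set (measurableTypeR R)) p t :
  measurable_fun D (fun x => x `^ p * expR (- (x ^+ 2 / (4 * t)))).
Proof.
apply: measurable_funM; first by apply: measurable_funTS; exact: measurable_powR.
apply: measurableT_comp => //; apply: measurableT_comp => //.
exact: measurable_funM.
Qed.

Lemma integrable_powR_gauss p t : 0 <= p -> 0 < t ->
  leb.-integrable `]0, +oo[ (EFin \o (fun x => x `^ p * expR (- (x ^+ 2 / (4 * t))))).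
Proof.
move=> p0 t0; apply: (@integrable_gauss_bound R _ (4 * t)^-1 p 1).
- by rewrite invr_gt0 mulr_gt0.
- exact: measurable_powR_gauss.
- move=> x x0; rewrite mul1r ger0_norm ?mulr_ge0 ?expR_ge0 ?powR_ge0//.
  exact: powR_gauss_le.
Qed.

(** The substitution y = x^2 / (4t) in the integral defining Gamma (m/2). *)
Lemma Rintegral_powR_gauss m t : 1 <= m -> 0 < t ->
  \int[leb]_(x in `]0, +oo[) (x `^ (m - 1) * expR (- (x ^+ 2 / (4 * t)))) =
  2 `^ (m - 1) * t `^ (m / 2) * Gamma (m / 2).
Proof.
move=> m1 t0; have k0 : 0 < (4 * t)^-1 by rewrite invr_gt0 mulr_gt0.
have tn0 : t != 0 by rewrite gt_eqF.
pose G y := y `^ (m / 2 - 1) * expR (- y).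
have G0 y : 0 < y -> 0 <= G y by rewrite mulr_ge0 ?powR_ge0 ?expR_ge0.
have cG y : 0 < y -> {for y, continuous G}.
  move=> y0; apply: cvgM; first exact: continuous_powR.
  apply: continuous_comp; first exact: opp_continuous.
  exact: continuous_expR.
have -> : Gamma (m / 2) = \int[leb]_(x in `]0, +oo[)
    ((2 `^ (m - 1) * t `^ (m / 2))^-1 * (x `^ (m - 1) * expR (- (x ^+ 2 / (4 * t))))).
  rewrite /Gamma {1}/Rintegral (ge0_integral_sqr_substitution G (4 * t)^-1 k0 G0 cG).
  rewrite /Rintegral; congr fine; apply: eq_integral => x.
  rewrite inE/= in_itv/= andbT => x0; congr EFin.
  rewrite /G (mulrC _^-1 (x ^+ 2)) mulrAC [RHS]mulrA.
  congr (_ * _).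
  have powRE (z p : R) : expR z `^ p = expR (p * z).
    by rewrite /powR gt_eqF ?expR_gt0// expRK.
  rewrite (_ : 2 * (4 * t)^-1 = (2 * t)^-1); last by field.
  rewrite (_ : 4 * t = 2 * 2 * t); last by ring.
  have -> : m - 1 = m / 2 + m / 2 - 1 by field.
  (* With x, t and 2 written as exponentials of their logarithms, the identity between powers
     becomes an identity between exponents. *)
  move: (m / 2) => q; rewrite -(lnK x0) -(lnK t0) -(lnK (ltr0n R 2)).
  rewrite !powRE expr2 -!expRD -!expRN -!expRD powRE -expRD; congr expR.
  by field.
rewrite RintegralZl ?mulVKf//; last first.
  by apply: integrable_powR_gauss; rewrite ?subr_ge0.
by rewrite mulf_neq0// gt_eqF// powR_gt0.
Qed.

(** The moment formula at m = 1, t = 1/4, where the Gaussian is exp (- x^2). It makes the constant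
    [c] equal to [eta] when m = 1. *)
Lemma Gamma_half : Gamma 2^-1 = Num.sqrt pi :> R.
Proof.
have q0 : 0 < 4^-1 :> R by rewrite invr_gt0.
have := Rintegral_powR_gauss 1 4^-1 (lexx _) q0.
rewrite subrr !powRr0 mul1r div1r powR12_sqrt ?ltW//.
rewrite (_ : 4^-1 = 2^-1 ^+ 2); last by field.
rewrite sqrtr_sqr ger0_norm//.
have -> : \int[leb]_(x in `]0, +oo[) (x `^ 0 * expR (- (x ^+ 2 / (4 * 2^-1 ^+ 2)))) =
    Num.sqrt pi / 2.
  have := @integral0y_gauss R; rewrite -integral_itv_obnd_cbnd; last first.
    by apply/measurable_EFinP; apply: measurable_funTS; exact: measurable_gauss_fun.
  move=> h; rewrite /Rintegral -[RHS]/(fine (Num.sqrt pi / 2)%:E) -h; congr fine.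
  apply: eq_integral => x _; rewrite powRr0 mul1r /gauss_fun.
  by rewrite (_ : 4 * 2^-1 ^+ 2 = 1) ?divr1//; field.
by move=> h; apply: (@mulfI _ 2^-1); rewrite ?invr_eq0// -h mulrC.
Qed.

Lemma cvg_powR_gauss_pinfty p t : 0 <= p -> 0 < t ->
  x `^ p * expR (- (x ^+ 2 / (4 * t))) @[x --> +oo] --> (0 : R).
Proof.
move=> p0 t0; pose a := (4 * t)^-1.
have a0 : 0 < a by rewrite invr_gt0 mulr_gt0.
pose K := expR ((p + 1) ^+ 2 / (4 * a)).
have KE : K * expR (- xi) @[xi --> +oo] --> (0 : R).
  by rewrite -(mulr0 K); apply: cvgMr; exact: cvgr_expR.
apply: squeeze_cvgr KE; last exact: cvg_cst.
near=> x; have x0 : 0 < x by near: x; exact: nbhs_pinfty_gt.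
rewrite mulr_ge0 ?powR_ge0 ?expR_ge0//=.
by rewrite (le_trans (powR_gauss_le p t x p0 x0))// gauss_le_expRN.
Unshelve. all: by end_near. Qed.

(** The derivative of x^m exp (- x^2 / (4t)) integrates to zero, both boundary values being 0. This
    is the integration by parts that relates the kernel of a power to its source. *)
Lemma moment_powR_gauss m t : 1 <= m -> 0 < t ->
  \int[leb]_(x in `]0, +oo[) (x `^ (m + 1) * expR (- (x ^+ 2 / (4 * t)))) =
  2 * t * m *
  \int[leb]_(x in `]0, +oo[) (x `^ (m - 1) * expR (- (x ^+ 2 / (4 * t)))).
Proof.
move=> m1 t0; have tn0 : t != 0 by rewrite gt_eqF.
have m0 : 0 < m by rewrite (lt_le_trans _ m1).
pose g p x := x `^ p * expR (- (x ^+ 2 / (4 * t))).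
have cg p x : 0 < x -> {for x, continuous (g p)}.
  move=> x0; apply: cvgM; first exact: continuous_powR.
  exact: continuous_gauss0.
have int1 : leb.-integrable `]0, +oo[ (EFin \o (fun x => m * g (m - 1) x)).
  by apply: (integrableZl _ m (integrable_powR_gauss (m - 1) t _ _)); rewrite ?subr_ge0.
have int2 : leb.-integrable `]0, +oo[ (EFin \o (fun x => (2 * t)^-1 * g (m + 1) x)).
  apply: (integrableZl _ (2 * t)^-1 (integrable_powR_gauss (m + 1) t _ _)) => //.
  by rewrite addr_ge0 ?ltW.
have : \int[leb]_(x in `]0, +oo[) (m * g (m - 1) x - (2 * t)^-1 * g (m + 1) x) = 0 - 0.
  apply: (@Rintegral_0y_FTC R _ (g m)).
  - exact: (@integrableB _ _ _ leb `]0, +oo[ (measurable_itv _) _ _ int1 int2).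
  - by move=> x x0; apply: cvgB; apply: cvgMr; exact: cg.
  - move=> x x0; have dp := is_derive1_powR m x0.
    have := is_deriveM dp (is_derive_gauss t 0 x tn0).
    rewrite (_ : _ * _ = g m); last first.
      by apply/funext => y; rewrite /g !fctE subr0.
    move=> /is_derive_eq; apply; rewrite /g subr0 /GRing.scale/=.
    rewrite [x `^ (m + 1)]powRD; last by rewrite (gt_eqF x0) implybT.
    rewrite powRr1 ?(ltW x0)//; move: (expR _) (x `^ m) (x `^ (m - 1)) => e p q.
    by field.
  - rewrite -[X in _ --> X](mul0r (expR (- (0 ^+ 2 / (4 * t))))); apply: cvgM.
      exact: powR_cvg0.
    apply: cvg_at_right_filter; exact: continuous_gauss0.
  - by apply: cvg_powR_gauss_pinfty => //; exact: ltW.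
rewrite subr0 RintegralB// !RintegralZl//; last 2 first.
  by apply: integrable_powR_gauss => //; rewrite addr_ge0 ?ltW.
  by apply: integrable_powR_gauss => //; rewrite subr_ge0.
rewrite -/(g (m + 1)) -/(g (m - 1)) => /eqP; rewrite subr_eq0 => /eqP E.
by rewrite -mulrA E mulVKf ?mulf_neq0.
Qed.

End GaussianMoments.

(** * Power data and the Volterra equation *)

Section PowerData.
Context {R : realType}.
Local Notation leb := (@lebesgue_measure R).
Implicit Types (f g G F phi Phi h V : R -> R) (s t x y a b C B xi l th m p k eta : R).

Lemma derive1_powR_data h eta m x : 0 < x ->
  (forall y, 0 < y -> h y = eta * y `^ m) -> h^`() x = eta * (m * x `^ (m - 1)).
Proof.
move=> x0 hE; rewrite derive1E (@near_eq_derive _ _ _ _ (fun y => eta * y `^ m)).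
- have dp := is_derive1_powR m x0; have d := is_deriveZ eta dp.
  by rewrite derive_val.
- by near=> y; apply: hE; near: y; exact: lt_nbhsr.
Unshelve. all: by end_near. Qed.

Lemma volterra_source_powR h eta m t : 1 <= m -> 0 < t ->
  (forall y, 0 < y -> h y = eta * y `^ m) ->
  volterra_source h t = (Num.sqrt (pi * t))^-1 * (eta * m *
    \int[leb]_(x in `]0, +oo[) (x `^ (m - 1) * expR (- (x ^+ 2 / (4 * t))))).
Proof.
move=> m1 t0 hE; rewrite /volterra_source; congr (_ * _).
rewrite -RintegralZl//; last by apply: integrable_powR_gauss; rewrite ?subr_ge0.
apply: eq_Rintegral => x; rewrite inE/= in_itv/= andbT => x0.
by rewrite (derive1_powR_data h eta m x x0 hE); ring.
Qed.

Lemma volterra_source_powRE h eta m t : 1 <= m -> 0 < t ->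
  (forall y, 0 < y -> h y = eta * y `^ m) ->
  volterra_source h t =
  2 `^ (m - 1) * m * eta / Num.sqrt pi * Gamma (m / 2) * t `^ ((m - 1) / 2).
Proof.
move=> m1 t0 hE; rewrite (volterra_source_powR h eta m t m1 t0 hE).
rewrite Rintegral_powR_gauss// sqrtrM ?pi_ge0//.
rewrite (_ : (m - 1) / 2 = m / 2 - 2^-1); last by field.
rewrite [t `^ (m / 2 - _)]powRB; last by rewrite (gt_eqF t0) implybT.
rewrite powR12_sqrt ?(ltW t0)//.
by field; rewrite !gt_eqF// sqrtr_gt0// pi_gt0.
Qed.

Lemma volterra_kernel_powR h eta m t : 1 <= m -> 0 < t ->
  (forall y, 0 < y -> h y = eta * y `^ m) ->
  volterra_kernel h t = volterra_source h t.
Proof.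
move=> m1 t0 hE; rewrite (volterra_source_powR h eta m t m1 t0 hE).
have -> : volterra_kernel h t = (2 * Num.sqrt pi * t `^ (3 / 2))^-1 * (eta *
    \int[leb]_(x in `]0, +oo[) (x `^ (m + 1) * expR (- (x ^+ 2 / (4 * t))))).
  rewrite /volterra_kernel; congr (_ * _); rewrite -RintegralZl//; last first.
    by apply: integrable_powR_gauss => //; rewrite addr_ge0// (le_trans _ m1).
  apply: eq_Rintegral => x; rewrite inE/= in_itv/= andbT => x0.
  rewrite hE// [x `^ (m + 1)]powRD; last by rewrite (gt_eqF x0) implybT.
  by rewrite powRr1 ?(ltW x0)//; ring.
rewrite moment_powR_gauss//.
have -> : t `^ (3 / 2) = t * Num.sqrt t.
  rewrite (_ : 3 / 2 = 1 + 2^-1); last by field.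
  by rewrite powRD ?powRr1 ?powR12_sqrt ?ltW// (gt_eqF t0) implybT.
rewrite sqrtrM ?pi_ge0//; field.
by rewrite !gt_eqF// sqrtr_gt0// pi_gt0.
Qed.

End PowerData.

(** * The Volterra equation with an exponential kernel *)

Section Volterra.
Context {R : realType}.
Local Notation leb := (@lebesgue_measure R).
Implicit Types (f g G F V : R -> R) (s t x y a b k : R).

Lemma integrable_expRM b f t :
  leb.-integrable `]0, t[ (EFin \o f) ->
  leb.-integrable `]0, t[ (EFin \o (fun x => expR (b * x) * f x)).
Proof.
move=> intf; have mf : measurable_fun (`]0, t[ : set R) f.
  by apply/measurable_EFinP; exact: measurable_int intf.
apply: (le_integrable _ _ _ (integrableZl _ (expR (`|b| * t)) intf)) => //.
  apply/measurable_EFinP; apply: measurable_funM => //.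
  by apply: measurableT_comp => //; exact: measurable_funM.
move=> x; rewrite /= in_itv/= => /andP[x0 xt]; rewrite lee_fin !normrM.
rewrite ler_wpM2r// !(ger0_norm (expR_ge0 _)) ler_expR.
rewrite (le_trans (ler_norm _))// normrM ler_wpM2l//.
by rewrite ger0_norm ltW.
Qed.

(** Passes to closed segments, on which the continuity and differentiability of parameterized
    integrals are applied. *)
Lemma Rintegral_itv_oo_cc f t :
  leb.-integrable `]0, t[ (EFin \o f) ->
  leb.-integrable `[0, t] (EFin \o f) /\
  \int[leb]_(x in `]0, t[) f x = \int[leb]_(x in `[0, t]) f x.
Proof.
move=> /integrableP[mf foo]; split.
  apply/integrableP; split.
    by apply/emeasurable_fun_itv_obnd_cbndP/emeasurable_fun_itv_bndo_bndcP.
  rewrite integral_itv_bndoo//; exact: measurableT_comp.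
by rewrite /Rintegral (@integral_itv_bndoo _ 0 t (EFin \o f) true false).
Qed.

(* [exp (- a t) * W t] is the convolution term, so that [W] solves the linear
   ODE [W' = exp (a t) * V0 + k * W], with integrating factor [exp (- k t)]. *)
Lemma volterra_exp_kernel V V0 a k t : 0 < t ->
  (forall s, 0 < s -> leb.-integrable `]0, s[ (EFin \o V)) ->
  (forall s, 0 < s -> leb.-integrable `]0, s[ (EFin \o V0)) ->
  (forall s, 0 < s -> {for s, continuous V0}) ->
  (forall s, 0 < s -> V s = V0 s + k * expR (- (a * s)) *
    \int[leb]_(x in `]0, s[) (expR (a * x) * V x)) ->
  V t = V0 t + k * expR (- ((a - k) * t)) *
    \int[leb]_(x in `]0, t[) (expR ((a - k) * x) * V0 x).
Proof.
move=> t0 intV intV0 cV0 VE.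
pose E x := expR (a * x) * V x.
have intE s : 0 < s -> leb.-integrable `]0, s[ (EFin \o E).
  by move=> s0; apply: integrable_expRM; exact: intV.
have intEc s : 0 < s -> leb.-integrable `[0, s] (EFin \o E).
  by move=> /intE/Rintegral_itv_oo_cc[].
pose W s := \int[leb]_(x in `[0, s]) E x.
have WE s : 0 < s -> V s = V0 s + k * expR (- (a * s)) * W s.
  by move=> s0; rewrite VE//; have [_ ->] := Rintegral_itv_oo_cc _ _ (intE s s0).
have cexp b : continuous (fun x => expR (b * x)).
  move=> x; apply: continuous_comp; last exact: continuous_expR.
  by apply: cvgMr; exact: cvg_id.
have s1 s : 0 < s -> 0 < s + 1 by move=> s0; rewrite addr_gt0.
have cW s : 0 < s -> {for s, continuous W}.
  (* Integrability up to s + 1 makes [s] an interior point. *)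
  move=> s0; have := parameterized_integral_continuous (ltW (s1 s s0)) (intEc _ (s1 s s0)).
  move=> /(continuous_within_itvP _ (s1 s s0))[+ _ _]; apply.
  by rewrite in_itv/= s0 ltrDl ltr01.
have W0 : W s @[s --> 0^'+] --> 0.
  apply: cvg_at_right_filter.
  exact: parameterized_integral_cvg_left t0 (intEc t t0).
(* Bootstrap: the equation expresses the merely integrable [V] through the continuous [V0] and [W],
   so [V] is continuous and [W] becomes differentiable. *)
have cV s : 0 < s -> {for s, continuous V}.
  move=> s0; rewrite /prop_for /continuous_at WE//.
  have : V0 x + k * expR (- (a * x)) * W x @[x --> s] -->
      V0 s + k * expR (- (a * s)) * W s.
    apply: cvgD; first exact: cV0.
    apply: cvgM; last exact: cW.
    apply: cvgMr; rewrite -mulNr; under eq_fun do rewrite -mulNr.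
    exact: cexp.
  apply: cvg_trans; apply: near_eq_cvg; near=> x.
  by rewrite WE//; near: x; exact: lt_nbhsr.
have dW s : 0 < s -> is_derive s 1 W (E s).
  move=> s0; have ss1 : s < s + 1 by rewrite ltrDl.
  have cE : {for s, continuous E} by apply: cvgM; [exact: cexp|exact: cV].
  have [dW1 dW2] := continuous_FTC1_closed ss1 (intEc _ (s1 s s0)) s0 cE.
  by apply: DeriveDef; [exact: dW1|rewrite -derive1E dW2].
(* In the derivative of [Z] the terms with [W] cancel and only [V0] remains, so [Z] is an explicit
   integral. *)
pose Z s := expR (- k * s) * W s.
have dZ s : 0 < s -> is_derive s 1 Z (expR ((a - k) * s) * V0 s).
  move=> s0; have dlin : is_derive s 1 (fun x => - k * x) (- k).
    have := is_deriveZ (- k) (is_derive_id s 1).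
    by move=> /is_derive_eq; apply; rewrite [LHS]mulr1.
  have := is_deriveM (is_derive_expR_comp _ _ _ dlin) (dW s s0).
  move=> /is_derive_eq; apply; rewrite /E WE// /GRing.scale/=.
  rewrite mulrBl expRD -[- (k * s)]mulNr expRN.
  by field; rewrite gt_eqF ?expR_gt0.
have Z0 : Z s @[s --> 0^'+] --> expR (- k * 0) * 0.
  by apply: cvgM W0; apply: cvg_at_right_filter; exact: cexp.
rewrite (@Rintegral_0t_FTC R _ Z _ t t0 _ _ dZ Z0); last 2 first.
- by apply: integrable_expRM; exact: intV0.
- by move=> s s0; apply: cvgM; [exact: cexp|exact: cV0].
rewrite mulr0 subr0 WE// /Z; congr (_ + _).
rewrite (_ : expR (- (a * t)) = expR (- ((a - k) * t)) * expR (- k * t)); first by ring.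
by rewrite -expRD; congr expR; ring.
Unshelve. all: by end_near. Qed.

End Volterra.

(** * Elementary integrals of powers and exponentials over []0, t[] *)

Section ClosedForms.
Context {R : realType}.
Local Notation leb := (@lebesgue_measure R).
Implicit Types (f g G F V : R -> R) (s t x y a b k p q d : R).

Let dpowR p x : 0 < x -> -1 < p -> is_derive x 1 (fun x => (p + 1)^-1 * x `^ (p + 1)) (x `^ p).
Proof.
move=> x0 p1; have := is_deriveZ (p + 1)^-1 (is_derive1_powR (p + 1) x0).
move=> /is_derive_eq; apply; rewrite /GRing.scale/= addrK mulKf//.
by rewrite gt_eqF// -ltrBlDr sub0r.
Qed.

Let cvg0_powR p : -1 < p -> (p + 1)^-1 * x `^ (p + 1) @[x --> 0^'+] --> (p + 1)^-1 * 0.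
Proof. by move=> p1; apply: cvgMr; apply: powR_cvg0; rewrite -ltrBlDr sub0r. Qed.

(** Covers the exponents in []-1, 0[] that arise as (m - 3)/2 for 1 < m < 3; the primitive x^(p+1) /
    (p+1) still vanishes at 0. *)
Lemma integrable_powR p t : -1 < p -> 0 < t ->
  leb.-integrable `]0, t[ (EFin \o (fun x => x `^ p)).
Proof.
move=> p1 t0; apply: (@ge0_integrable_0t_FTC R _ (fun x => (p + 1)^-1 * x `^ (p + 1)) _ t t0).
- by move=> x _; exact: powR_ge0.
- by move=> x; exact: continuous_powR.
- by move=> x x0; exact: dpowR.
- exact: cvg0_powR.
Qed.

Lemma Rintegral_powR p t : -1 < p -> 0 < t ->
  \int[leb]_(x in `]0, t[) x `^ p = (p + 1)^-1 * t `^ (p + 1).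
Proof.
move=> p1 t0.
rewrite (@Rintegral_0t_FTC R _ (fun x => (p + 1)^-1 * x `^ (p + 1)) _ t t0 _ _ _
  (cvg0_powR p p1)); first by rewrite mulr0 subr0.
- exact: integrable_powR.
- by move=> x; exact: continuous_powR.
- by move=> x x0; exact: dpowR.
Qed.

Let dexpR d x : is_derive x 1 (fun x => expR (d * x)) (d * expR (d * x)).
Proof.
have := is_derive_expR_comp _ _ _ (is_deriveZ d (is_derive_id x 1)).
by move=> /is_derive_eq; apply; rewrite [d *: 1]mulr1 mulrC.
Qed.

Let cexpR d : continuous (fun x => expR (d * x)).
Proof.
move=> x; apply/differentiable_continuous/derivable1_diffP.
by have := dexpR d x => ?; exact: ex_derive.
Qed.

Lemma Rintegral_expR d t : d != 0 -> 0 < t ->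
  \int[leb]_(x in `]0, t[) expR (d * x) = (expR (d * t) - 1) / d.
Proof.
move=> d0 t0; transitivity (d^-1 * expR (d * t) - d^-1 * expR (d * 0)); last first.
  by rewrite mulr0 expR0; field.
apply: (@Rintegral_0t_FTC R _ (fun x => d^-1 * expR (d * x)) _ t t0).
- have /(integrable_expRM d) : leb.-integrable `]0, t[ (EFin \o (fun x => x `^ 0)).
    by apply: integrable_powR => //; rewrite ltrN10.
  by under [X in _.-integrable _ X -> _]eq_fun do rewrite /= powRr0 mulr1.
- by move=> x _; exact: cexpR.
- move=> x _; have := is_deriveZ d^-1 (dexpR d x).
  by move=> /is_derive_eq; apply; rewrite [LHS]mulKf.
- by apply: cvgMr; apply: cvg_at_right_filter; exact: cexpR.
Qed.

(** Integration by parts, with no boundary term at 0 because [q] is positive. It lowers the exponent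
    (m - 1)/2 of the Volterra solution to the (m - 3)/2 of the flux formula. *)
Lemma Rintegral_expR_powR d q t : 0 < q -> 0 < t ->
  d * \int[leb]_(x in `]0, t[) (expR (d * x) * x `^ q) =
  expR (d * t) * t `^ q - q * \int[leb]_(x in `]0, t[) (expR (d * x) * x `^ (q - 1)).
Proof.
move=> q0 t0; have q1 : -1 < q by rewrite (lt_trans _ q0)// ltrN10.
have q2 : -1 < q - 1 by rewrite ltrBrDr addNr.
have i1 := integrable_expRM d _ _ (integrable_powR q t q1 t0).
have i2 := integrable_expRM d _ _ (integrable_powR (q - 1) t q2 t0).
have j1 : leb.-integrable `]0, t[ (EFin \o (fun x => d * (expR (d * x) * x `^ q))).
  exact: (integrableZl _ d i1).
have j2 : leb.-integrable `]0, t[ (EFin \o (fun x => q * (expR (d * x) * x `^ (q - 1)))).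
  exact: (integrableZl _ q i2).
rewrite -RintegralZl// -RintegralZl//.
apply/esym/eqP; rewrite subr_eq -RintegralD//; apply/eqP.
rewrite -[LHS]subr0 -[X in _ - X](mulr0 (expR (d * 0))); apply/esym.
apply: (@Rintegral_0t_FTC R _ (fun x => expR (d * x) * x `^ q) _ t t0).
- exact: (@integrableD _ _ _ leb `]0, t[ (measurable_itv _) _ _ j1 j2).
- by move=> x x0; apply: cvgD; apply: cvgMr; apply: cvgM;
    by [exact: cexpR|exact: continuous_powR].
- move=> x x0; have := is_deriveM (dexpR d x) (is_derive1_powR q x0).
  by move=> /is_derive_eq; apply; rewrite /GRing.scale/=; ring.
- by apply: cvgM; [apply: cvg_at_right_filter; exact: cexpR|exact: powR_cvg0].
Qed.

End ClosedForms.

(** * From the integral representation to the boundary flux *)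

Section BoundaryFlux.
Context {R : realType}.
Local Notation leb := (@lebesgue_measure R).

Lemma boundary_flux_representation (nu lambda mu eta m : R) (h Phi V : R -> R)
    (u : R -> R -> R) (t : R) : 1 <= m -> 0 < t ->
  (forall x, 0 < x -> h x = eta * x `^ m) ->
  (forall x, 0 < x -> Phi x = - mu * sin (lambda * x)) ->
  volterra_solution nu h Phi V ->
  (forall x, 0 <= x -> u x t = integral_representation nu h Phi V x t) ->
  has_boundary_flux u t (V t).
Proof.
move=> m1 t0 hE PhiE [intV VE] uE; rewrite /has_boundary_flux VE//.
rewrite -(volterra_kernel_powR h eta m t m1 t0 hE).
have mh : measurable_fun (`]0, +oo[ : set R) h.
  apply: (@eq_measurable_fun _ _ _ _ _ (fun x => eta * x `^ m)).
    by move=> x; rewrite inE/= in_itv/= andbT => x0; rewrite hE.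
  by apply: measurable_funM => //; apply: measurable_funTS; exact: measurable_powR.
have hb x : 0 < x -> `|h x| <= `|eta| * expR (m * x).
  move=> x0; rewrite hE// normrM ler_wpM2l// ger0_norm ?powR_ge0//.
  by rewrite powR_le_expR// (le_trans ler01 m1).
have hlim := @cvg_green_quotient R h `|eta| m t t0 (normr_ge0 _) mh hb.
(* Both the convolution in the Volterra equation and the forcing term of [u] are multiples of this
   number, with factors - mu lambda and - mu sin (lambda x). *)
pose I := \int[leb]_(tau in `]0, t[) (expR (- (lambda ^+ 2 * (t - tau))) * V tau).
have intI : leb.-integrable `]0, t[
    (EFin \o (fun tau => expR (- (lambda ^+ 2 * (t - tau))) * V tau)).
  rewrite (_ : (fun tau => _) =
      fun tau => expR (- (lambda ^+ 2 * t)) * (expR (lambda ^+ 2 * tau) * V tau)).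
    exact: (integrableZl _ _ (integrable_expRM (lambda ^+ 2) _ _ (intV t t0))).
  apply/funext => tau; rewrite mulrA -expRD.
  by rewrite (_ : - (lambda ^+ 2 * t) + _ = - (lambda ^+ 2 * (t - tau)))//; ring.
have -> : \int[leb]_(tau in `]0, t[) (volterra_kernel Phi (t - tau) * V tau) =
    - (mu * lambda) * I.
  rewrite /I -RintegralZl//; apply: eq_Rintegral => tau.
  rewrite inE/= in_itv/= => /andP[_ taut].
  rewrite (@volterra_kernel_sin R Phi (- mu) lambda)// ?subr_gt0//; ring.
have IG x : \int[leb]_(tau in `]0, t[)
    ((\int[leb]_(xi in `]0, +oo[) (green x t xi tau * Phi xi)) * V tau) =
    - (mu * sin (lambda * x)) * I.
  rewrite /I -RintegralZl//; apply: eq_Rintegral => tau.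
  rewrite inE/= in_itv/= => /andP[_ taut].
  rewrite (@Rintegral_green_sin R Phi (- mu) lambda)//; ring.
have u0 : u 0 t = 0.
  rewrite uE// /integral_representation IG mulr0 sin0 mulr0 oppr0 mul0r mulr0 subr0.
  rewrite (_ : (fun xi => green 0 t xi 0 * h xi) = cst 0) ?Rintegral_cst ?mul0r//.
  by apply/funext => xi; rewrite green0 mul0r.
have : x^-1 * \int[leb]_(xi in `]0, +oo[) (green x t xi 0 * h xi) +
    nu * mu * I * (x^-1 * sin (lambda * x)) @[x --> (0 : R)^'+] -->
    volterra_kernel h t + nu * mu * I * lambda.
  by apply: cvgD => //; apply: cvgMr; exact: cvg_sin_quotient.
rewrite (_ : nu * mu * I * lambda = - (nu * (- (mu * lambda) * I))); last by ring.
apply: cvg_trans; apply: near_eq_cvg; near=> x.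
have x0 : 0 < x by [].
rewrite /boundary_quotient u0 subr0 uE ?ltW// /integral_representation IG.
by field; rewrite gt_eqF.
Unshelve. all: by end_near. Qed.

End BoundaryFlux.

Theorem proposition2p4 (R : realType) (nu lambda mu eta m : R)
  (h Phi : R -> R) (F u : R -> R -> R) (V : R -> R)
  (nu_gt0 : 0 < nu) (lambda_gt0 : 0 < lambda) (mu_gt0 : 0 < mu)
  (eta_neq0 : eta != 0) (m_ge1 : 1 <= m)
  (FE : forall v t : R, 0 < t -> F v t = nu * v)
  (hE : forall x : R, 0 < x -> h x = eta * x `^ m)
  (PhiE : forall x : R, 0 < x -> Phi x = - mu * sin (lambda * x))
  (u_sol : solves_heat_problem h Phi F u)
  (V_sol : volterra_solution nu h Phi V)
  (u_repr : forall x t : R, 0 <= x -> 0 < t ->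
     u x t = integral_representation nu h Phi V x t) :
  let delta := lambda - nu * mu in
  let c := 2 `^ (m - 1) * m * eta / Num.sqrt pi * Gamma (m / 2) in
  (delta != 0 -> forall t : R, 0 < t ->
     has_boundary_flux u t
       (if m == 1 then
          eta / delta * (lambda - nu * mu * expR (- (lambda * delta * t)))
        else
          c * lambda / delta * t `^ ((m - 1) / 2)
          - c * (m - 1) * nu * mu / (2 * delta) * expR (- (lambda * delta * t))
            * \int[lebesgue_measure]_(tau in `]0, t[)
                (tau `^ ((m - 3) / 2) * expR (lambda * delta * tau))))
  /\
  (delta = 0 -> forall t : R, 0 < t ->
     has_boundary_flux u t
       (if m == 1 then
          eta * (1 + lambda ^+ 2 * t)
        else
          c * t `^ ((m - 1) / 2)
          + 2 * c * lambda ^+ 2 / (m + 1) * t `^ ((m + 1) / 2))).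
Proof.
move=> delta c.
have [intV VE] := V_sol.
pose q := (m - 1) / 2; pose V0 t := c * t `^ q.
have q0 : 0 <= q by rewrite divr_ge0 ?subr_ge0.
have q1 : -1 < q by rewrite (lt_le_trans _ q0)// ltrN10.
have intq t : 0 < t ->
    (@lebesgue_measure R).-integrable `]0, t[ (EFin \o (fun x => x `^ q)).
  by move=> t0; exact: integrable_powR.
(* The Volterra equation in the form solved above, with a = lambda^2 and k = nu mu lambda, so that
   the resulting rate a - k is lambda delta. *)
have V_eq t : 0 < t -> V t = V0 t + nu * mu * lambda * expR (- (lambda ^+ 2 * t)) *
    \int[lebesgue_measure]_(x in `]0, t[) (expR (lambda ^+ 2 * x) * V x).
  move=> t0; rewrite VE// (volterra_source_powRE h eta m t m_ge1 t0 hE) -/c -/(V0 t).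
  congr (_ + _).
  transitivity (- (nu * (- (mu * lambda) * expR (- (lambda ^+ 2 * t)) *
    \int[lebesgue_measure]_(x in `]0, t[) (expR (lambda ^+ 2 * x) * V x)))); last by ring.
  congr (- (_ * _)); rewrite -RintegralZl//; last by apply: integrable_expRM; exact: intV.
  apply: eq_Rintegral => tau; rewrite inE/= in_itv/= => /andP[_ taut].
  rewrite (@volterra_kernel_sin R Phi (- mu) lambda)// ?subr_gt0//.
  rewrite (_ : - (lambda ^+ 2 * (t - tau)) = - (lambda ^+ 2 * t) + lambda ^+ 2 * tau).
    by rewrite expRD; ring.
  by ring.
have V_sol' t : 0 < t -> V t = V0 t + nu * mu * lambda * c * expR (- (lambda * delta * t)) *
    \int[lebesgue_measure]_(x in `]0, t[) (expR (lambda * delta * x) * x `^ q).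
  move=> t0; have dE : lambda ^+ 2 - nu * mu * lambda = lambda * delta.
    by rewrite /delta; ring.
  rewrite (volterra_exp_kernel V V0 _ _ t t0 intV _ _ V_eq).
  - rewrite dE; congr (_ + _).
    rewrite (_ : nu * mu * lambda * c * _ * _ = nu * mu * lambda *
      expR (- (lambda * delta * t)) * (c * \int[lebesgue_measure]_(x in `]0, t[)
        (expR (lambda * delta * x) * x `^ q))); last by ring.
    congr (_ * _); rewrite -RintegralZl//; last by apply: integrable_expRM; exact: intq.
    by apply: eq_Rintegral => x _; rewrite /V0; ring.
  - move=> s s0; exact: (integrableZl _ c (intq s s0)).
  - by move=> s s0; apply: cvgMr; exact: continuous_powR.
have flux t : 0 < t -> has_boundary_flux u t (V t).
  move=> t0; apply: (boundary_flux_representation nu lambda mu eta m h Phi) => //.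
  by move=> x x0; exact: u_repr.
have c1 : m = 1 -> c = eta.
  move=> mE; rewrite /c mE subrr powRr0 !mul1r Gamma_half.
  by rewrite divfK// gt_eqF// sqrtr_gt0 pi_gt0.
split => [d0 t t0|d0 t t0]; have := flux t t0; rewrite V_sol'// /V0.
- have ld : lambda * delta != 0 by rewrite mulf_neq0// gt_eqF.
  (* Used to rewrite the target, where [lambda] occurs without [delta] absorbing it; the remaining
     identities are then rational in [delta] and nu mu. *)
  have lE : lambda = delta + nu * mu by rewrite /delta; ring.
  have ln0 : lambda != 0 by rewrite gt_eqF.
  set e := expR (- (lambda * delta * t)).
  have eE : e * expR (lambda * delta * t) = 1 by rewrite /e expRN mulVf// gt_eqF ?expR_gt0.
  case: eqVneq => [mE|m1].
    rewrite c1// (_ : q = 0); last by rewrite /q mE subrr mul0r.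
    under eq_Rintegral do rewrite powRr0 mulr1.
    rewrite Rintegral_expR// powRr0 mulr1.
    rewrite (_ : _ + _ = eta / delta * (lambda - nu * mu * e))//.
    (* The exponential and its inverse are grouped so that [eE] replaces their product by 1. *)
    transitivity (eta + nu * mu * eta / delta * (e * expR (lambda * delta * t) - e)).
      by field; rewrite d0.
    by rewrite eE [in RHS]lE; field.
  (* Strict positivity of [q] is what allows the integration by parts, and the reason why m = 1 is a
     separate case. *)
  have qgt0 : 0 < q by rewrite divr_gt0// subr_gt0 lt_neqAle eq_sym m1.
  have := Rintegral_expR_powR (lambda * delta) q t qgt0 t0.
  have -> : \int[lebesgue_measure]_(tau in `]0, t[)
      (tau `^ ((m - 3) / 2) * expR (lambda * delta * tau)) =
    \int[lebesgue_measure]_(x in `]0, t[) (expR (lambda * delta * x) * x `^ (q - 1)).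
    apply: eq_Rintegral => x _; rewrite [LHS]mulrC.
    by rewrite (_ : (m - 3) / 2 = q - 1)// /q; field.
  set I := Rintegral _ _ _; set J := Rintegral _ _ _ => IJ.
  rewrite (_ : _ + _ = c * lambda / delta * t `^ q -
    c * (m - 1) * nu * mu / (2 * delta) * e * J)//.
  have -> : m - 1 = 2 * q by rewrite /q; field.
  have -> : I = (expR (lambda * delta * t) * t `^ q - q * J) / (lambda * delta).
    by rewrite -IJ [RHS]mulrC mulKf.
  transitivity (c * t `^ q + nu * mu * c / delta *
      ((e * expR (lambda * delta * t)) * t `^ q - q * e * J)).
    by field; rewrite d0 ln0.
  by rewrite eE [in RHS]lE; field.
(* For delta = 0 the rate vanishes: the solution is [V0] plus a multiple of the integral of a pure
   power, and nu mu = lambda. *)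
- rewrite d0 mulr0 mul0r oppr0 expR0 mulr1.
  under eq_Rintegral do rewrite mul0r expR0 mul1r.
  rewrite Rintegral_powR//.
  have nmE : nu * mu = lambda by apply/esym/eqP; rewrite -subr_eq0 -/delta d0.
  rewrite nmE; case: eqVneq => [mE|m1].
    rewrite c1// (_ : q = 0); last by rewrite /q mE subrr mul0r.
    rewrite add0r powRr0 powRr1 ?(ltW t0)//.
    by rewrite (_ : _ + _ = eta * (1 + lambda ^+ 2 * t))//; field.
  rewrite (_ : q + 1 = (m + 1) / 2); last by rewrite /q; field.
  rewrite (_ : _ + _ = c * t `^ q + 2 * c * lambda ^+ 2 / (m + 1) * t `^ ((m + 1) / 2))//.
  by field; rewrite gt_eqF// ltr_wpDl// (le_trans ler01 m_ge1).
Qed.
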